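(* Let $k\ge1$ be an integer, $\lambda_1,\lambda_2>0$ and $0<\alpha\le1$. Let $\{\mathcal{S}^{k}_{\alpha}(t)\}_{t\ge0}$ be the fractional Skellam process of order $k$ with parameters $\lambda_1,\lambda_2,\alpha$. For $0<\theta<1$ and $t\ge 0$, its probability generating function $G^{k}_{\alpha}(\theta,t)=\mathbb{E}\left(\theta^{\mathcal{S}^{k}_{\alpha}(t)}\right)$ is given by $$G^{k}_{\alpha}(\theta,t)=E_{\alpha,1}\left(-\left(k(\lambda_{1}+\lambda_{2})-\lambda_{1}\sum_{j=1}^{k}\theta^{j}-\lambda_{2}\sum_{j=1}^{k}\theta^{-j}\right)t^{\alpha}\right),$$ where $E_{\alpha,1}$ is the Mittag-Leffler function.
   Context: Poisson process of order $k$ (PPoK) with intensity $\lambda>0$: $N^k(t)=\sum_{i=1}^{N(t)}X_i$, where $\{N(t)\}_{t\ge0}$ is a Poisson process with intensity $k\lambda$, and $\{X_i\}_{i\ge1}$ are iid, uniform on $\{1,2,\dots,k\}$, and independent of $\{N(t)\}_{t\ge0}$. Skellam process of order $k$ (SPoK): $S^k(t)=N_1^k(t)-N_2^k(t)$, where $\{N_1^k(t)\}_{t\ge0}$ and $\{N_2^k(t)\}_{t\ge0}$ are independent PPoK with intensities $\lambda_1>0$ and $\lambda_2>0$, respectively. Inverse stable subordinator: for $0<\alpha<1$, the stable subordinator $\{D_\alpha(t)\}_{t\ge0}$ is the subordinator with $\mathbb{E}(e^{-sD_\alpha(t)})=e^{-ts^\alpha}$, $s>0$, and $Y_\alpha(t)=\inf\{r\ge0: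 D_\alpha(r)>t\}$, $t\ge 0$. Fractional Skellam process of order $k$ (FSPoK): $\mathcal{S}^k_\alpha(t)=S^k(Y_\alpha(t))$ for $0<\alpha<1$, where $\{Y_\alpha(t)\}_{t\ge0}$ is independent of $\{S^k(t)\}_{t\ge0}$, and $\mathcal{S}^k_1(t)=S^k(t)$ for $\alpha=1$. Mittag-Leffler function: $E_{\alpha,1}(x)=\sum_{m=0}^{\infty}\frac{x^m}{\Gamma(m\alpha+1)}$, $x\in\mathbb{R}$. *)

(* Defs.v *)
From HB Require Import structures.
From mathcomp Require Import all_boot all_order all_algebra finmap.
From mathcomp Require Import all_classical all_reals all_analysis.

Set Implicit Arguments.
Unset Strict Implicit.
Unset Printing Implicit Defensive.

Import Order.TTheory GRing.Theory Num.Theory.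
Import numFieldNormedType.Exports.

Local Open Scope classical_set_scope.
Local Open Scope ring_scope.

Section SpecialFunctions.
Context {R : realType}.
Implicit Types alpha x : R.

(* Euler's integral: meaningful for 0 < x only. *)
Definition Gamma x : R :=
  \int[@lebesgue_measure R]_(t in `]0, +oo[) (t `^ (x - 1) * expR (- t)).

(* The one-parameter Mittag-Leffler function E_{alpha,1}, for 0 < alpha. *)
Definition mittag_leffler alpha x : R :=
  limn (series (fun m : nat => x ^+ m / Gamma (m%:R * alpha + 1))).

End SpecialFunctions.

Section Independence.
Context d (T : measurableType d) (R : realType) (P : probability T R).

(* The sigma-algebra generated by the X i with i in D. *)
Definition sigma_family (I : Type) d' (U : measurableType d')
    (D : set I) (X : I -> T -> U) : set (set T) :=
  <<s \bigcup_(i in D) preimage_set_system setT (X i) measurable >>.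

Definition independent2 (F G : set (set T)) : Prop :=
  forall A B, F A -> G B -> P (A `&` B) = (P A * P B)%E.

Definition mutually_independent (I : choiceType) (F : I -> set (set T)) : Prop :=
  forall (J : {fset I}) (A : I -> set T),
    (forall i, i \in J -> F i (A i)) ->
    P (\bigcap_(i in [set` J]) A i) = (\prod_(i <- J) P (A i))%E.

End Independence.

(* Processes indexed by [0, +oo) are functions of type R -> T -> U of which
   only the values at nonnegative times matter. *)
Section Processes.
Context d (T : measurableType d) (R : realType) (P : probability T R).

Definition times : set R := [set t | 0 <= t].

Definition is_process d' (U : measurableType d') (X : R -> T -> U) : Prop :=
  forall t : R, 0 <= t -> measurable_fun setT (X t).

Definition independent_processes d1 (U1 : measurableType d1)
    d2 (U2 : measurableType d2) (X : R -> T -> U1) (Y : R -> T -> U2) : Prop :=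
  independent2 P (sigma_family times X) (sigma_family times Y).

Definition cadlag (f : R -> R) : Prop :=
  forall t : R, 0 <= t ->
    (f x @[x --> t^'+] --> f t) /\ (0 < t -> cvg (f x @[x --> t^'-])).

(* The finitely many times 0 <= t_0 <= ... <= t_n of the usual definition are
   the initial segments of nondecreasing sequences, and mutual independence
   only involves finite subfamilies. *)
Definition independent_increments (X : R -> T -> R) : Prop :=
  forall t : nat -> R, 0 <= t 0%N -> (forall i, t i <= t i.+1) ->
    mutually_independent P (fun i : nat =>
      preimage_set_system setT (fun w => X (t i.+1) w - X (t i) w) measurable).

Definition stationary_increments (X : R -> T -> R) : Prop :=
  forall (s t : R) (B : set R), 0 <= s -> 0 <= t -> measurable B ->
    P [set w | B (X (s + t) w - X s w)] = P [set w | B (X t w - X 0 w)].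

Definition levy_process (X : R -> T -> R) : Prop :=
  [/\ is_process X,
      {ae P, forall w, X 0 w = 0},
      independent_increments X,
      stationary_increments X &
      {ae P, forall w, cadlag (X ^~ w)}].

(* [poisson_pmf 0] is not the mass function of the Dirac mass at 0, hence
   0 < t; at time 0 the law is fixed by [levy_process]. *)
Definition poisson_process (lambda : R) (N : R -> T -> nat) : Prop :=
  [/\ is_process N,
      levy_process (fun t w => (N t w)%:R) &
      forall (t : R) (n : nat), 0 < t ->
        P [set w | N t w = n] = (poisson_pmf (lambda * t) n)%:E].

Definition iid_uniform (k : nat) (X : nat -> T -> nat) : Prop :=
  [/\ forall i, measurable_fun setT (X i),
      mutually_independent P
        (fun i => preimage_set_system setT (X i) measurable) &
      forall i j, (1 <= j <= k)%N -> P [set w | X i w = j] = (k%:R^-1)%:E].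

(* The jumps X_1, X_2, ... are indexed from 0. *)
Definition PPoK (k : nat) (lambda : R) (M : R -> T -> nat) : Prop :=
  exists (N : R -> T -> nat) (X : nat -> T -> nat),
    [/\ poisson_process (k%:R * lambda) N,
        iid_uniform k X,
        independent2 P (sigma_family times N) (sigma_family setT X) &
        forall (t : R) w, 0 <= t -> M t w = (\sum_(i < N t w) X i w)%N].

Definition SPoK (k : nat) (lambda1 lambda2 : R) (S : R -> T -> R) : Prop :=
  exists N1 N2 : R -> T -> nat,
    [/\ PPoK k lambda1 N1, PPoK k lambda2 N2,
        independent_processes N1 N2 &
        forall (t : R) w, 0 <= t -> S t w = (N1 t w)%:R - (N2 t w)%:R].

Definition stable_subordinator (alpha : R) (D : R -> T -> R) : Prop :=
  [/\ levy_process D,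
      {ae P, forall w, forall s t : R, 0 <= s -> s <= t -> D s w <= D t w} &
      forall s t : R, 0 < s -> 0 <= t ->
        'E_P[fun w => (expR (- (s * D t w)))%R]%E =
          (expR (- (t * s `^ alpha)))%:E].

Definition inverse_stable_subordinator (alpha : R) (Y : R -> T -> R) : Prop :=
  exists D : R -> T -> R,
    [/\ stable_subordinator alpha D,
        is_process Y &
        forall (t : R) w, 0 <= t -> Y t w = inf [set r | 0 <= r /\ t < D r w]].

Definition FSPoK (k : nat) (lambda1 lambda2 alpha : R) (Z : R -> T -> R) : Prop :=
  (alpha = 1 /\ SPoK k lambda1 lambda2 Z) \/
  (0 < alpha < 1 /\
   exists S Y : R -> T -> R,
     [/\ SPoK k lambda1 lambda2 S,
         inverse_stable_subordinator alpha Y,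
         independent_processes Y S,
         is_process Z &
         forall (t : R) w, 0 <= t -> Z t w = S (Y t w) w]).

End Processes.

Arguments times {R}.

(* Main.v *)
From HB Require Import structures.
Require Import Defs.
From mathcomp Require Import all_boot all_order all_algebra finmap.
From mathcomp Require Import all_classical all_reals all_analysis.
From mathcomp Require Import measurable_realfun.
From mathcomp Require Import ring lra.

(** The law of a Skellam process of order [k] at time [r] has the generating
    function [expR (mu * r)], where [mu] is [skellam_exponent]: conditioning on the
    Poisson number of jumps gives each Poisson process of order [k], and the two
    are independent. For [alpha = 1] this is the statement, since the
    Mittag-Leffler function is then the exponential.

    For [alpha < 1], conditioning on the time change [Y] replaces [expR (mu * r)] by
    the expectation of [expR (mu * Y t)] ([pgf_subordinated]). It remains to show
    that this moment generating function is of Mittag-Leffler type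
    ([inverse_stable_mgf]). The stable subordinator is self-similar, because its
    Laplace transform is and a positive random variable is determined by its
    Laplace transform ([laplace_tail_eq]); for this uniqueness, indicators of
    half-lines are approximated by explicit polynomials in [expR (- (s * X))]. As the
    events [Y t < r] and [t < D r] almost coincide, [Y t] has the law of
    [(t / D 1) `^ alpha]. The negative moments of [D 1] follow from its Laplace
    transform and Euler's integral by an exchange of integrals
    ([stable_moment]), and the exponential series may be integrated term by term
    because the Mittag-Leffler series converges absolutely
    ([normed_mittag_leffler_cvg]).

    The difference of the two processes of order [k] may have large negative
    values, where a power of [theta < 1] is unbounded. The passage to the limit in
    [pgf_subordinated] is therefore based on a second moment bound
    ([integral_lim_L2_bounded]), which is the generating function at
    [theta ^+ 2]. *)

Set Implicit Arguments.
Unset Strict Implicit.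
Unset Printing Implicit Defensive.

Import Order.TTheory GRing.Theory Num.Theory.
Import numFieldNormedType.Exports.

Local Open Scope classical_set_scope.
Local Open Scope ring_scope.

(** * Integration under independence and limits of integrals *)

Section Integration.
Context d (T : measurableType d) (R : realType) (P : probability T R).
Local Open Scope ereal_scope.

(** Independence says that the image under [X] of [P] restricted to [A] is
    [P A] times the image of [P]; integrate [g] against both measures. *)
Lemma integral_indep d' (U : measurableType d') (X : T -> U) (A : set T)
    (g : U -> \bar R) :
  measurable_fun setT X -> measurable A -> measurable_fun setT g ->
  (forall u, 0 <= g u) ->
  (forall B, measurable B -> P (A `&` X @^-1` B) = P A * P (X @^-1` B)) ->
  \int[P]_(w in A) g (X w) = P A * \int[P]_w g (X w).
Proof.
move=> mX mA mg g0 indep.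
have mgX : measurable_fun setT (g \o X) by exact: measurableT_comp.
have PA0 : (0 <= fine (P A))%R by rewrite fine_ge0.
have PAE : P A = (NngNum PA0)%:num%:E by rewrite /= fineK// fin_num_measure.
transitivity (\int[mrestr P mA]_w g (X w)).
  rewrite [RHS](@ge0_negligible_integral _ _ _ _ _ (~` A))//; first last.
    by rewrite /= /mrestr setICl measure0.
    exact: measurableC.
  rewrite setDE setCK setTI; apply: eq_measure_integral => B mB BA.
  by rewrite /= /mrestr setIidl.
have push (m : {measure set T -> \bar R}) :
    \int[m]_w g (X w) = \int[pushforward m X]_u g u.
  by rewrite (ge0_integral_pushforward mX).
rewrite !push PAE -ge0_integral_mscale//.
apply: eq_measure_integral => B mB _.
by rewrite /= /pushforward /mscale /mrestr/= setIC indep// PAE.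
Qed.

Lemma measurable_preimage d' (U : measurableType d') (X : T -> U) (B : set U) :
  measurable_fun setT X -> measurable B -> measurable (X @^-1` B).
Proof. by move=> mX mB; rewrite -[X in measurable X]setTI; exact: mX. Qed.

Lemma measurable_nat_family d' (U : measurableType d') (K : T -> nat)
    (F : nat -> T -> U) :
  measurable_fun setT K -> (forall n, measurable_fun setT (F n)) ->
  measurable_fun setT (fun w => F (K w) w).
Proof.
move=> mK mF _ B mB; rewrite setTI.
rewrite (_ : _ @^-1` B = \bigcup_n (K @^-1` [set n] `&` F n @^-1` B)).
  by apply: bigcup_measurable => n _; apply: measurableI; exact: measurable_preimage.
apply/seteqP; split => w /=; first by exists (K w).
by move=> [n _ [/= <-]].
Qed.

Lemma integral_partition (X : T -> nat) (A : set T) (f : T -> \bar R) :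
  measurable_fun setT X -> measurable A -> measurable_fun setT f ->
  (forall w, 0 <= f w) ->
  \int[P]_(w in A) f w = \sum_(n <oo) \int[P]_(w in A `&` X @^-1` [set n]) f w.
Proof.
move=> mX mA mf f0; rewrite -ge0_integral_bigcup//.
- congr (integral _ _ _); apply/seteqP; split => [w Aw|w [n _ []]//].
  by exists (X w).
- by move=> n; apply: measurableI => //; exact: measurable_preimage.
- exact: measurable_funS mf.
- by move=> i j _ _ [w [[_ /= <-] [_ /= <-]]].
Qed.

(** Cutting along the values of the discrete variable avoids product measures. *)
Lemma integral_indep_mul d' (U : measurableType d') (X : T -> nat) (Y : T -> U)
    (f : nat -> \bar R) (g : U -> \bar R) :
  measurable_fun setT X -> measurable_fun setT Y -> measurable_fun setT g ->
  (forall n, 0 <= f n) -> (forall u, 0 <= g u) ->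
  \int[P]_w g (Y w) \is a fin_num ->
  (forall n B, measurable B ->
    P (X @^-1` [set n] `&` Y @^-1` B) = P (X @^-1` [set n]) * P (Y @^-1` B)) ->
  \int[P]_w (f (X w) * g (Y w)) = \int[P]_w f (X w) * \int[P]_w g (Y w).
Proof.
move=> mX mY mg f0 g0 gfin indep.
have mf : measurable_fun setT f by [].
have mfX : measurable_fun setT (f \o X) by exact: measurableT_comp.
have mgY : measurable_fun setT (g \o Y) by exact: measurableT_comp.
rewrite (integral_partition mX)//; last 2 first.
- exact: emeasurable_funM.
- by move=> w; exact: mule_ge0.
rewrite [X in _ = X * _](integral_partition mX)// muleC -(fineK gfin) -nneseriesZl; last first.
  by move=> n _; apply: integral_ge0.
apply: eq_eseriesr => n _; rewrite (fineK gfin) setTI muleC.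
have mXn : measurable (X @^-1` [set n]) by exact: measurable_preimage.
transitivity (\int[P]_(w in X @^-1` [set n]) (f n * g (Y w))).
  by apply: eq_integral => w /set_mem/= ->.
rewrite ge0_integralZl//; last exact: measurable_funTS.
rewrite (integral_indep mY mXn mg g0 (indep n)) muleA; congr (_ * _).
transitivity (\int[P]_(w in X @^-1` [set n]) f n); first by rewrite integral_cst.
by apply: eq_integral => w /set_mem/= ->.
Qed.

(** Fatou's lemma in the form in which it is used: only upper bounds of the
    integrals of the approximants are known. *)
Lemma ge0_fatou_cvg (f_ : nat -> T -> \bar R) (f : T -> \bar R) (u : nat -> \bar R)
    (l : \bar R) :
  (forall n, measurable_fun setT (f_ n)) -> measurable_fun setT f ->
  (forall n w, 0 <= f_ n w) -> (forall w, 0 <= f w) ->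
  {ae P, forall w, f_ ^~ w @ \oo --> f w} ->
  (forall n, \int[P]_w f_ n w <= u n) -> u @ \oo --> l ->
  \int[P]_w f w <= l.
Proof.
move=> mf_ mf f_0 f0 f_f f_u ul.
have -> : \int[P]_w f w = \int[P]_w limn_einf (f_ ^~ w).
  apply: ge0_ae_eq_integral => //.
  - apply: (@emeasurable_fun_cvg _ _ _ _ (fun n w => einfs (f_ ^~ w) n)).
      exact: measurable_fun_einfs.
    by move=> w _; rewrite limn_einf_lim; exact: is_cvg_einfs.
  - move=> w _; rewrite limn_einf_lim; apply: lime_ge; first exact: is_cvg_einfs.
    by apply: nearW => n; apply: le_ereal_inf_tmp => _ [m _ <-].
  - apply: filterS f_f => w f_fw _.
    by rewrite is_cvg_limn_einfE; [rewrite (cvg_lim _ f_fw)|apply/cvg_ex; exists (f w)].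
apply: le_trans (fatou _ _ _ _) _ => //.
rewrite -(cvg_lim _ ul)// -is_cvg_limn_einfE; last by apply/cvg_ex; exists l.
rewrite !limn_einf_lim; apply: lee_lim; [exact: is_cvg_einfs|exact: is_cvg_einfs|].
apply: nearW => n; apply: le_ereal_inf_tmp => _ [m /= nm <-].
by apply: ge_ereal_inf; exists (\int[P]_w f_ m w) => //; exists m.
Qed.

(** Boundedness in L2 gives uniform integrability. Fatou's lemma for [f_ n]
    yields one inequality; for the other one it is applied to the nonnegative
    functions [c * x ^+ 2 + (4 * c)^-1 - x] at [x = f_ n w], whose quadratic part
    costs at most [c * C] in the limit, with [c] arbitrarily small. *)
Lemma integral_lim_L2_bounded (f_ : nat -> T -> R) (f : T -> R) (l_ : nat -> R)
    (l C : R) :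
  (forall n, measurable_fun setT (f_ n)) -> measurable_fun setT f ->
  (forall n w, 0 <= f_ n w)%R -> (forall w, 0 <= f w)%R ->
  {ae P, forall w, f_ ^~ w @ \oo --> f w} ->
  (forall n, \int[P]_w (f_ n w)%:E = (l_ n)%:E) -> l_ @ \oo --> l ->
  (forall n, \int[P]_w (f_ n w ^+ 2)%:E <= C%:E) ->
  \int[P]_w (f w)%:E = l%:E.
Proof.
move=> mf_ mf f_0 f0 f_f f_l ll f_C.
have le_l : \int[P]_w (f w)%:E <= l%:E.
  apply: (@ge0_fatou_cvg (fun n w => (f_ n w)%:E) _ (fun n => (l_ n)%:E)) => //.
  - by move=> n; apply/measurable_EFinP.
  - exact/measurable_EFinP.
  - by apply: filterS f_f => w ?; apply/fine_cvgP; split => //; exact: nearW.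
  - by move=> n; rewrite f_l.
  - by apply/fine_cvgP; split => //; exact: nearW.
have f_fin : \int[P]_w (f w)%:E \is a fin_num.
  rewrite ge0_fin_numE; first exact: le_lt_trans le_l (ltry _).
  by apply: integral_ge0 => w _; rewrite lee_fin.
have C0 : (0 <= C)%R.
  rewrite -lee_fin; apply: le_trans (f_C 0%N); apply: integral_ge0 => w _.
  by rewrite lee_fin sqr_ge0.
apply/eqP; rewrite eq_le le_l/= -(fineK f_fin) lee_fin.
apply/ler_addgt0Pr => e e0.
(* c is chosen so that c * C <= e. *)
pose c := (e / (C + 1))%R.
have c0 : (0 < c)%R by rewrite divr_gt0// ltr_pwDr.
have cC : (c * C <= e)%R.
  by rewrite /c mulrAC ler_pdivrMr ?ltr_pwDr// ler_wpM2l// ?(ltW e0)// lerDl.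
clearbody c.
pose q (x : R) : R := (c * x ^+ 2 + (4 * c)^-1 - x)%R.
have qE x : (q x = c * (x - (2 * c)^-1) ^+ 2)%R.
  by rewrite /q; field; rewrite gt_eqF.
have q0 x : (0 <= q x)%R by rewrite qE mulr_ge0// ?sqr_ge0// ltW.
have qD x : (q x + x = c * x ^+ 2 + (4 * c)^-1)%R by rewrite /q subrK.
have mq (g : T -> R) : measurable_fun setT g -> measurable_fun setT (q \o g).
  move=> mg; rewrite (_ : q \o g =
    ((cst c \* (fun w => g w ^+ 2)) \+ cst (4 * c)^-1) \- g)%R//.
  apply: measurable_funB => //; apply: measurable_funD => //.
  by apply: measurable_funM => //; exact: measurable_funX.
have qint (g : T -> R) : measurable_fun setT g -> (forall w, 0 <= g w)%R ->
    \int[P]_w (q (g w))%:E + \int[P]_w (g w)%:E =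
    c%:E * \int[P]_w (g w ^+ 2)%:E + ((4 * c)^-1)%:E.
  move=> mg g0; rewrite -ge0_integralD//.
  - under eq_integral do rewrite -EFinD qD EFinD EFinM.
    rewrite ge0_integralD//.
    + rewrite ge0_integralZl//.
      * by rewrite integral_cst//= probability_setT mule1.
      * by apply/measurable_EFinP; exact: measurable_funX.
      * by move=> w _; rewrite lee_fin sqr_ge0.
      * by rewrite lee_fin ltW.
    + by move=> w _; rewrite -EFinM lee_fin mulr_ge0 ?sqr_ge0 ?ltW.
    + apply/measurable_EFinP; apply: measurable_funM => //; exact: measurable_funX.
    + by move=> w _; rewrite lee_fin invr_ge0 mulr_ge0 ?ltW.
  - by move=> w _; rewrite lee_fin.
  - by apply/measurable_EFinP; exact: mq.
  - by move=> w _; rewrite lee_fin.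
  - by apply/measurable_EFinP.
have : \int[P]_w (q (f w))%:E <= (c * C + (4 * c)^-1 - l)%:E.
  apply: (@ge0_fatou_cvg (fun n w => (q (f_ n w))%:E) _
    (fun n => (c * C + (4 * c)^-1 - l_ n)%:E)) => //.
  - by move=> n; apply/measurable_EFinP; exact: mq.
  - by apply/measurable_EFinP; exact: mq.
  - by move=> n w; rewrite lee_fin.
  - by move=> w; rewrite lee_fin.
  - apply: filterS f_f => w fw; apply/fine_cvgP; split => //; first exact: nearW.
    apply: cvgB => //; apply: cvgD; last exact: cvg_cst.
    by apply: cvgM; [exact: cvg_cst|rewrite expr2; under eq_fun do rewrite expr2; exact: cvgM].
  - move=> n; rewrite EFinB leeBrDr// -f_l qint// EFinD leeD2r// EFinM.
    by rewrite lee_pmul2l.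
  - apply/fine_cvgP; split => //; first exact: nearW.
    by apply: cvgB => //; exact: cvg_cst.
rewrite EFinB leeBrDr// => h.
have : ((4 * c)^-1)%:E <= \int[P]_w (q (f w))%:E + \int[P]_w (f w)%:E.
  rewrite qint// -[leLHS]add0e leeD2r// mule_ge0 ?lee_fin ?(ltW c0)//.
  by apply: integral_ge0 => w _; rewrite lee_fin sqr_ge0.
have qfin : \int[P]_w (q (f w))%:E \is a fin_num.
  rewrite ge0_fin_numE; last by apply: integral_ge0 => w _; rewrite lee_fin.
  by apply: le_lt_trans (ltry (c * C + (4 * c)^-1 - l)); rewrite EFinB leeBrDr.
move: h; rewrite -(fineK f_fin) -(fineK qfin) -!EFinD !lee_fin /=.
by move=> h1 h2; lra.
Qed.

End Integration.

(** * Euler's integral and the Mittag-Leffler series *)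

Section GammaIntegral.
Context {R : realType}.
Implicit Types a b c x : R.
Local Open Scope ereal_scope.
Notation mu := (@lebesgue_measure R).

(** Euler's integral with values in the extended reals, so that its
    finiteness can be proved rather than presupposed. *)
Definition euler_integral a : \bar R :=
  \int[mu]_(u in `]0%R, +oo[) (u `^ a * expR (- u))%:E.

Lemma GammaE a : Gamma (a + 1) = fine (euler_integral a).
Proof. by rewrite /Gamma /Rintegral /euler_integral addrK. Qed.

Let measurable_expRN (D : set R) : measurable_fun D (fun u : R => expR (- u)).
Proof.
apply: measurable_funTS; apply: measurableT_comp => //; exact: oppr_measurable.
Qed.

Let measurable_euler a (D : set R) :
  measurable_fun D (fun u : R => u `^ a * expR (- u))%R.
Proof.
apply: measurable_funM; last exact: measurable_expRN.
by apply: measurable_funTS; exact: measurable_powR.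
Qed.

Lemma integral_expRN b : \int[mu]_(u in `]b, +oo[) (expR (- u))%:E = (expR (- b))%:E.
Proof.
rewrite integral_itv_obnd_cbnd; last exact/measurable_EFinP.
have cE : continuous (fun u : R => expR (- u))%R.
  by move=> u; apply: continuous_comp; [exact: continuousN|exact: continuous_expR].
rewrite (@ge0_continuous_FTC2y _ _ (fun u => - expR (- u))%R _ 0%R).
- by rewrite EFinN oppeK add0e.
- by move=> u _; exact: expR_ge0.
- exact: continuous_subspaceT.
- by rewrite -oppr0; apply: cvgN; exact: cvgr_expR.
- by move=> u _; exact: ex_derive.
- by apply: cvg_at_right_filter; apply: cvgN; exact: cE.
- move=> u _; rewrite derive1E; apply: derive_val.
  by apply: is_derive_eq; rewrite /GRing.scale/= ?mulrN ?mulNr ?mulr1 ?mul1r opprK.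
Qed.

Lemma integral_pow n c : (0 <= c)%R ->
  \int[mu]_(r in `]0%R, c[) (n.+1%:R * r ^+ n)%:E = (c ^+ n.+1)%:E.
Proof.
rewrite le_eqVlt => /predU1P[<-|c0].
  by rewrite set_itvoo0// integral_set0 expr0n.
have mf (D : set R) : measurable_fun D (fun r : R => n.+1%:R * r ^+ n)%R.
  by apply: measurable_funTS; apply: measurable_funM => //; exact: measurable_funX.
rewrite integral_itv_bndo_bndc; last exact/measurable_EFinP.
rewrite integral_itv_obnd_cbnd; last exact/measurable_EFinP.
have cX m : continuous (fun r : R => r ^+ m)%R by exact: exprn_continuous.
rewrite (@continuous_FTC2 _ _ (fun r => r ^+ n.+1)%R)//.
- by rewrite expr0n/= sube0.
- apply: continuous_subspaceT => r; apply: cvgM; [exact: cvg_cst|exact: cX].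
- split.
  + by move=> r _; exact: exprn_derivable.
  + by apply: cvg_at_right_filter; exact: cX.
  + by apply: cvg_at_left_filter; exact: cX.
- by move=> r _; rewrite exp_derive1.
Qed.

(** The two ways of describing the region over which the double integral of
    the layer-cake formula below is taken. *)
Lemma powR_swap a x u r : (0 < a)%R -> (0 < x)%R -> (0 <= u)%R -> (0 <= r)%R ->
  ((x * r `^ a^-1 < u) = (r < u `^ a * (x `^ a)^-1))%R *
  ((x * r `^ a^-1 <= u) = (r <= u `^ a * (x `^ a)^-1))%R.
Proof.
move=> a0 x0 u0 r0; rewrite ltr_pdivlMr ?ler_pdivlMr ?powR_gt0//.
have -> : (r * x `^ a = (x * r `^ a^-1) `^ a)%R.
  by rewrite powRM ?powR_ge0 ?(ltW x0)// -powRrM mulVf ?gt_eqF// powRr1// mulrC.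
have xr0 : (0 <= x * r `^ a^-1)%R by rewrite mulr_ge0 ?powR_ge0// ltW.
have mono := le_mono_in (gt0_ltr_powR a0).
by rewrite mono ?nnegrE// (leW_mono_in mono) ?nnegrE.
Qed.

(** Layer-cake formula: write the power [n.+1] of [(u / x) `^ a] as the integral
    of [n.+1%:R * r ^+ n] over [0 < r < (u / x) `^ a] and exchange the integrals
    in [u] and [r]; the one in [u] is then an exponential tail. *)
Lemma euler_integral_layer a x n : (0 < a)%R -> (0 < x)%R ->
  \int[mu]_(u in `]0%R, +oo[) ((u `^ a * (x `^ a)^-1) ^+ n.+1 * expR (- u))%:E =
  \int[mu]_(r in `]0%R, +oo[) (n.+1%:R * r ^+ n * expR (- (x * r `^ a^-1)))%:E.
Proof.
move=> a0 x0.
pose A := [set p : R * R | (0 < p.2)%R && (x * p.2 `^ a^-1 < p.1)%R].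
have mA : measurable A.
  rewrite (_ : A = [set p | (0 < p.2)%R] `&` [set p | (x * p.2 `^ a^-1 < p.1)%R]); last first.
    by apply/seteqP; split=> p /andP.
  have m2 : measurable_fun setT (snd : R * R -> R) by exact: measurable_snd.
  have m1 : measurable_fun setT (fst : R * R -> R) by exact: measurable_fst.
  apply: measurableI.
  - have : measurable_fun setT (fun p : R * R => (0 < p.2)%R).
      exact: measurable_fun_ltr.
    by move=> /(_ measurableT [set true]); rewrite setTI; exact.
  - have : measurable_fun setT (fun p : R * R => (x * p.2 `^ a^-1 < p.1)%R).
      apply: measurable_fun_ltr => //; apply: measurable_funM => //.
      by apply: (measurableT_comp (measurable_powR a^-1)).
    by move=> /(_ measurableT [set true]); rewrite setTI; exact.
pose f (p : R * R) := (\1_A p * (n.+1%:R * p.2 ^+ n * expR (- p.1)))%R.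
have mf : measurable_fun setT (EFin \o f).
  apply/measurable_EFinP; apply: measurable_funM; first exact: measurable_indic.
  apply: measurable_funM.
    by apply: measurable_funM => //; apply: measurable_funX; exact: measurable_snd.
  apply: measurableT_comp => //.
  by apply: measurableT_comp; [exact: oppr_measurable|exact: measurable_fst].
have f0 p : 0 <= (f p)%:E.
  rewrite lee_fin /f indicE; have [/set_mem/= /andP[p20 _]|_] := boolP (p \in A).
    by rewrite mul1r mulr_ge0 ?expR_ge0// mulr_ge0// exprn_ge0// ltW.
  by rewrite mul0r.
have fE u r : f (u, r) =
    (if (0 < r) && (x * r `^ a^-1 < u) then n.+1%:R * r ^+ n * expR (- u) else 0)%R.
  rewrite /f indicE.
  have -> : ((u, r) \in A) = (0 < r)%R && (x * r `^ a^-1 < u)%R.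
    by apply/idP/idP; rewrite inE.
  by case: ifPn => _; rewrite ?mul1r ?mul0r.
have := @fubini_tonelli _ _ _ _ R mu mu (EFin \o f) mf f0.
have -> : \int[mu]_u \int[mu]_r (EFin \o f) (u, r) =
    \int[mu]_(u in `]0%R, +oo[) ((u `^ a * (x `^ a)^-1) ^+ n.+1 * expR (- u))%:E.
  rewrite [RHS]integral_mkcond; apply: eq_integral => u _; rewrite patchE.
  have [|u0] := boolP (u \in _).
  - rewrite inE/= in_itv/= andbT => u0.
    pose c := (u `^ a * (x `^ a)^-1)%R.
    have c0 : (0 <= c)%R by rewrite mulr_ge0 ?powR_ge0 ?invr_ge0 ?powR_ge0.
    transitivity (\int[mu]_(r in `]0%R, c[) ((n.+1%:R * r ^+ n)%:E * (expR (- u))%:E)).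
      rewrite [RHS]integral_mkcond; apply: eq_integral => r _; rewrite patchE.
      rewrite /= fE mem_setE in_itv/=.
      have [r0|r0] := ltP 0%R r; last by [].
      by rewrite /= (powR_swap a0 x0 (ltW u0) (ltW r0)); case: ifPn.
    rewrite ge0_integralZr//.
    + by rewrite integral_pow.
    + apply/measurable_EFinP; apply: measurable_funM => //; exact: measurable_funX.
    + move=> r; rewrite /= in_itv/= => /andP[r0 _].
      by rewrite lee_fin mulr_ge0// exprn_ge0// ltW.
  - apply: integral0_eq => r _; rewrite /= fE; case: ltP => r0//=.
    rewrite ltNge (le_trans (_ : u <= 0)%R)//.
      by move: u0; rewrite notin_setE/= in_itv/= andbT => /negP; rewrite -leNgt.
    by rewrite mulr_ge0 ?powR_ge0// ltW.
move=> ->; rewrite [RHS]integral_mkcond; apply: eq_integral => r _; rewrite patchE.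
have [|r0] := boolP (r \in _).
- rewrite inE/= in_itv/= andbT => r0.
  have c0 : (0 <= n.+1%:R * r ^+ n)%R by rewrite mulr_ge0// exprn_ge0// ltW.
  transitivity (\int[mu]_(u in `](x * r `^ a^-1)%R, +oo[)
      ((n.+1%:R * r ^+ n)%:E * (expR (- u))%:E)).
    rewrite [RHS]integral_mkcond; apply: eq_integral => u _; rewrite patchE.
    by rewrite /= fE mem_setE in_itv/= andbT r0/=; case: ifPn.
  rewrite ge0_integralZl//.
  + by rewrite integral_expRN.
  + apply/measurable_EFinP; exact: measurable_expRN.
- apply: integral0_eq => u _; rewrite /= fE; case: ltP => r0'//=.
  by move: r0; rewrite notin_setE/= in_itv/= r0'.
Qed.

(** Integrated over a random [x], the right-hand side is a Laplace transform:
    this turns the Laplace transform of a variable into its negative moments.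
    At [a = x = 1] it is the functional equation of the Gamma function. *)
Lemma euler_integral_scale a x n : (0 < a)%R -> (0 < x)%R ->
  euler_integral (n.+1%:R * a) * ((x `^ a)^-1 ^+ n.+1)%:E =
  \int[mu]_(r in `]0%R, +oo[) (n.+1%:R * r ^+ n * expR (- (x * r `^ a^-1)))%:E.
Proof.
move=> a0 x0; rewrite -euler_integral_layer// /euler_integral -ge0_integralZr//.
- apply: eq_integral => u; rewrite inE/= in_itv/= andbT => u0.
  rewrite -EFinM; congr EFin.
  have -> : (u `^ (n.+1%:R * a) = (u `^ a) ^+ n.+1)%R.
    by rewrite mulrC powRrM powR_mulrn ?powR_ge0.
  by rewrite exprMn mulrAC.
- apply/measurable_EFinP; exact: measurable_euler.
- by move=> u _; rewrite lee_fin mulr_ge0 ?powR_ge0 ?expR_ge0.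
- by rewrite lee_fin exprn_ge0// invr_ge0 powR_ge0.
Qed.

Lemma euler_integral_ge0 a : 0 <= euler_integral a.
Proof.
by apply: integral_ge0 => u _; rewrite lee_fin mulr_ge0 ?powR_ge0 ?expR_ge0.
Qed.

Lemma euler_integral_nat n : euler_integral n%:R = n`!%:R%:E.
Proof.
elim: n => [|n IHn].
  rewrite /euler_integral; under eq_integral do rewrite powRr0 mul1r.
  by rewrite integral_expRN oppr0 expR0.
have := @euler_integral_scale 1 1 n ltr01 ltr01.
rewrite mulr1 powR1 invr1 expr1n mule1 => ->.
rewrite factS natrM EFinM -IHn /euler_integral -ge0_integralZl//.
- apply: eq_integral => u; rewrite inE/= in_itv/= andbT => u0.
  by rewrite powR_mulrn ?(ltW u0)// powRr1 ?(ltW u0)// mul1r -EFinM mulrA.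
- apply/measurable_EFinP; exact: measurable_euler.
- by move=> u _; rewrite lee_fin mulr_ge0 ?powR_ge0 ?expR_ge0.
Qed.

Lemma Gamma_nat n : Gamma (n%:R + 1 : R)%R = n`!%:R :> R.
Proof. by rewrite GammaE euler_integral_nat. Qed.

Lemma euler_integral_fin_num a : (0 <= a)%R -> euler_integral a \is a fin_num.
Proof.
move=> a0; rewrite ge0_fin_numE ?euler_integral_ge0//.
pose n := (Num.truncn a).+1.
apply: (@le_lt_trans _ _ (euler_integral 0%:R + euler_integral n%:R)); last first.
  by rewrite !euler_integral_nat -EFinD ltry.
rewrite /euler_integral -ge0_integralD//.
- apply: ge0_le_integral => //.
  + by move=> u _; rewrite lee_fin mulr_ge0 ?powR_ge0 ?expR_ge0.
  + apply/measurable_EFinP; exact: measurable_euler.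
  + apply: emeasurable_funD; apply/measurable_EFinP; exact: measurable_euler.
  + move=> u; rewrite /= in_itv/= andbT => u0.
    rewrite -EFinD lee_fin -mulrDl ler_wpM2r ?expR_ge0// powRr0.
    have [u1|u1] := leP 1%R u.
      by rewrite (le_trans (ler_powR u1 (ltW (truncnS_gt a))))// lerDr.
    rewrite -[leLHS]addr0 lerD ?powR_ge0//.
    by rewrite -(powRr0 u); apply: ger_powR => //; rewrite u0 ltW.
- by move=> u _; rewrite lee_fin mulr_ge0 ?powR_ge0 ?expR_ge0.
- apply/measurable_EFinP; exact: measurable_euler.
- by move=> u _; rewrite lee_fin mulr_ge0 ?powR_ge0 ?expR_ge0.
- apply/measurable_EFinP; exact: measurable_euler.
Qed.

(** Keep only the part [b < u] of Euler's integral. As [b] is arbitrary, the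
    Gamma function grows faster than any geometric sequence. *)
Lemma Gamma_ge a b : (0 <= a)%R -> (0 < b)%R -> (b `^ a * expR (- b) <= Gamma (a + 1))%R.
Proof.
move=> a0 b0; rewrite GammaE -lee_fin fineK ?euler_integral_fin_num//.
rewrite EFinM -integral_expRN -ge0_integralZl//.
- apply: (@le_trans _ _ (\int[mu]_(u in `]b, +oo[) (u `^ a * expR (- u))%:E)).
    apply: ge0_le_integral => //.
    + by move=> u _; rewrite -EFinM lee_fin mulr_ge0 ?powR_ge0 ?expR_ge0.
    + by apply/measurable_EFinP; apply: measurable_funM => //; exact: measurable_expRN.
    + apply/measurable_EFinP; exact: measurable_euler.
    + move=> u; rewrite /= in_itv/= andbT => bu.
      rewrite -EFinM lee_fin ler_wpM2r ?expR_ge0//.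
      by apply: ge0_ler_powR; rewrite // ?nnegrE ltW// (lt_trans b0).
  apply: ge0_subset_integral => //.
  + apply/measurable_EFinP; exact: measurable_euler.
  + by move=> u _; rewrite lee_fin mulr_ge0 ?powR_ge0 ?expR_ge0.
  + by move=> u; rewrite /= !in_itv/= !andbT; exact: lt_trans.
- apply/measurable_EFinP; exact: measurable_expRN.
- by rewrite lee_fin powR_ge0.
Qed.

Lemma Gamma_gt0 a : (0 <= a)%R -> (0 < Gamma (a + 1))%R.
Proof.
move=> a0; apply: lt_le_trans (Gamma_ge a0 ltr01).
by rewrite mulr_gt0 ?powR_gt0 ?expR_gt0.
Qed.

Local Open Scope ring_scope.

Lemma normed_mittag_leffler_cvg a x : 0 < a ->
  cvgn (series (fun m => `|x| ^+ m / Gamma (m%:R * a + 1))).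
Proof.
move=> a0.
(* With b `^ a = c the term of index m is at most expR b * (`|x| / c) ^+ m. *)
pose c := 2 * `|x| + 1.
have c0 : 0 < c by rewrite ltr_wpDl// mulr_ge0.
pose b := c `^ a^-1.
have b0 : 0 < b by rewrite powR_gt0.
apply: (@series_le_cvg _ _ (geometric (expR b) (2^-1))).
- by move=> m; rewrite divr_ge0 ?exprn_ge0// ltW// Gamma_gt0// mulr_ge0// ltW.
- by move=> m; rewrite /geometric/= mulr_ge0 ?expR_ge0.
- move=> m; rewrite /geometric/=.
  have ma0 : 0 <= m%:R * a by rewrite mulr_ge0// ltW.
  rewrite ler_pdivrMr ?Gamma_gt0//.
  apply: le_trans (ler_wpM2l _ (Gamma_ge ma0 b0)); last first.
    by rewrite mulr_ge0 ?expR_ge0.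
  have -> : b `^ (m%:R * a) = c ^+ m.
    by rewrite /b -powRrM mulrCA mulVf ?gt_eqF// mulr1 powR_mulrn// ltW.
  have -> : expR b * 2^-1 ^+ m * (c ^+ m * expR (- b)) = (c / 2) ^+ m.
    rewrite exprMn expRN; field.
    by rewrite gt_eqF ?expR_gt0.
  rewrite lerXn2r ?nnegrE// ?divr_ge0 ?(ltW c0)//.
  by rewrite ler_pdivlMr// /c mulrC lerDl.
- apply: is_cvg_geometric_series.
  by rewrite ger0_norm// invf_lt1// ltr1n.
Qed.

Lemma mittag_leffler1 x : mittag_leffler 1 x = expR x.
Proof.
rewrite /mittag_leffler /expR; congr (limn (series _)).
by apply/funext => m; rewrite mulr1 Gamma_nat.
Qed.

End GammaIntegral.

(** * Laplace transforms of positive random variables *)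

Section StepPolynomial.
Context {R : realType}.
Implicit Types x y q r : R.

Lemma ler_1Dn_exp m y : 0 <= y -> 1 + m%:R * y <= (1 + y) ^+ m.
Proof.
move=> y0; elim: m => [|m IH]; first by rewrite mul0r addr0 expr0.
rewrite exprS (le_trans _ (ler_wpM2l _ IH)) ?addr_ge0//.
rewrite -natr1 mulrDl mul1r; have : 0 <= m%:R * y * y by rewrite !mulr_ge0.
by move: (m%:R * y) => z h; nra.
Qed.

Lemma ler_1Bn_exp m y : 0 <= y <= 1 -> 1 - m%:R * y <= (1 - y) ^+ m.
Proof.
move=> /andP[y0 y1]; elim: m => [|m IH]; first by rewrite mul0r subr0 expr0.
rewrite exprS (le_trans _ (ler_wpM2l _ IH)) ?subr_ge0//.
rewrite -natr1 mulrDl mul1r; have : 0 <= m%:R * y * y by rewrite !mulr_ge0.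
by move: (m%:R * y) => z h; nra.
Qed.

(** Compare with [q] the arithmetic mean of 1 and [r]: then [r <= q ^+ 2], the
    sequence [m%:R * q ^+ m] is bounded by Bernoulli's inequality, and a factor
    [q ^+ m] is left. *)
Lemma cvg_natr_mul_expr r : 0 <= r < 1 -> m%:R * r ^+ m @[m --> \oo] --> 0.
Proof.
move=> /andP[r0 r1].
pose q := (1 + r) / 2.
have q0 : 0 < q by rewrite /q; lra.
have q1 : q < 1 by rewrite /q; lra.
have rq : r <= q ^+ 2.
  have -> : q ^+ 2 = r + ((1 - r) / 2) ^+ 2 by rewrite /q; field.
  by rewrite lerDl sqr_ge0.
pose e := q^-1 - 1.
have e0 : 0 < e by rewrite subr_gt0 invf_gt1.
have qe m : m%:R * q ^+ m <= e^-1.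
  have : 1 + m%:R * e <= (1 + e) ^+ m by apply: ler_1Dn_exp; exact: ltW.
  rewrite [1 + e]addrC subrK exprVn => h.
  rewrite -[e^-1]mul1r ler_pdivlMr// mulrAC -ler_pdivlMr ?exprn_gt0// mul1r.
  by rewrite (le_trans _ h)// lerDr.
apply: (@squeeze_cvgr _ _ _ _ (cst 0) (fun m => e^-1 * q ^+ m)).
- apply: nearW => m; rewrite mulr_ge0 ?exprn_ge0//=.
  apply: (@le_trans _ _ (m%:R * q ^+ m * q ^+ m)).
    by rewrite -mulrA ler_wpM2l// -exprD addnn -mul2n exprM lerXn2r// nnegrE// exprn_ge0// ltW.
  by rewrite ler_wpM2r// exprn_ge0// ltW.
- exact: cvg_cst.
- rewrite -[X in _ --> X](mulr0 e^-1); apply: cvgM; first exact: cvg_cst.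
  by apply: cvg_expr; rewrite ger0_norm// ltW.
Qed.

(** In the limit these polynomials jump from 1 to 0 at 1/2: where [2 * x < 1] the
    product [m * 2 ^ m * x ^+ m] tends to 0, and otherwise it is at least [m]. The
    factor [m] in the exponent makes the limit 0 at the point 1/2 itself, so that
    atoms need no separate treatment. *)
Definition step_poly m : {poly R} := (1 - 'X^m) ^+ (m * 2 ^ m).

Lemma step_poly_itv m x : 0 <= x <= 1 -> 0 <= (step_poly m).[x] <= 1.
Proof.
move=> /andP[x0 x1]; rewrite /step_poly !hornerE.
have xm1 : x ^+ m <= 1 by rewrite exprn_ile1.
by rewrite exprn_ge0 ?subr_ge0// exprn_ile1 ?subr_ge0// gerBl exprn_ge0.
Qed.

Lemma cvg_step_poly x : 0 <= x <= 1 -> (step_poly m).[x] @[m --> \oo] --> ((x < 2^-1)%R%:R : R).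
Proof.
move=> x01; have /andP[x0 x1] := x01.
have NE m : (m * 2 ^ m)%:R * x ^+ m = m%:R * (2 * x) ^+ m.
  by rewrite natrM natrX -mulrA -exprMn.
have xm01 m : 0 <= x ^+ m <= 1 by rewrite exprn_ge0// exprn_ile1.
have [x2|x2] := ltP x 2^-1.
  apply: (@squeeze_cvgr _ _ _ _ (fun m => 1 - m%:R * (2 * x) ^+ m) (cst 1)).
  - apply: nearW => m; have /andP[_ ->] := step_poly_itv m x01; rewrite andbT.
    by rewrite -NE /step_poly !hornerE; exact: ler_1Bn_exp.
  - rewrite -[X in _ --> X]subr0; apply: cvgB; first exact: cvg_cst.
    by apply: cvg_natr_mul_expr; lra.
  - exact: cvg_cst.
apply: (@squeeze_cvgr _ _ _ _ (cst 0) (fun m => expR (- 1) ^+ m)).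
- apply: nearW => m; have /andP[->/= _] := step_poly_itv m x01.
  rewrite /step_poly !hornerE -expRM_natl mulrN1.
  apply: (@le_trans _ _ (expR (- x ^+ m) ^+ (m * 2 ^ m))).
    rewrite lerXn2r ?nnegrE ?expR_ge0 ?subr_ge0//; last exact: expR_ge1Dx.
    by have /andP[] := xm01 m.
  rewrite -expRM_natl ler_expR mulrN lerN2 NE ler_peMr//.
  by rewrite exprn_ege1//; lra.
- exact: cvg_cst.
- by apply: cvg_expr; rewrite ger0_norm ?expR_ge0// expR_lt1 ltrN10.
Qed.

End StepPolynomial.

Section LaplaceTransform.
Context d (T : measurableType d) (R : realType) (P : probability T R).

Lemma measurable_le_fun (X : T -> R) a : measurable_fun setT X ->
  measurable [set w | X w <= a].
Proof.
move=> mX; rewrite -[X in measurable X]setTI.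
have := measurable_fun_ler mX (measurable_cst (a : R)).
by move=> /(_ measurableT [set true]); rewrite setTI; exact.
Qed.

Lemma measurable_gt_fun (X : T -> R) a : measurable_fun setT X ->
  measurable [set w | a < X w].
Proof.
move=> mX; rewrite (_ : [set w | _] = ~` [set w | X w <= a]).
  by apply: measurableC; exact: measurable_le_fun.
by apply/seteqP; split => w /=; rewrite real_leNgt ?num_real//;
  [move=> ->|move/negP; rewrite negbK].
Qed.

Lemma measurable_ge_fun (X : T -> R) a : measurable_fun setT X ->
  measurable [set w | a <= X w].
Proof.
move=> mX; rewrite -[X in measurable X]setTI.
have := measurable_fun_ler (measurable_cst (a : R)) mX.
by move=> /(_ measurableT [set true]); rewrite setTI; exact.
Qed.

Lemma measurable_expRM (X : T -> R) s : measurable_fun setT X ->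
  measurable_fun setT (fun w => expR (s * X w)).
Proof. by move=> mX; apply: measurableT_comp => //; exact: measurable_funM. Qed.

(** Where [X w <= 0] the integrand is at least 1, while the Laplace transform
    tends to 0 as [s] grows. *)
Lemma laplace_null_le0 (X : T -> R) (a c : R) : 0 < a -> 0 < c ->
  measurable_fun setT X ->
  (forall s, 0 < s ->
    (\int[P]_w (expR (- (s * X w)))%:E = (expR (- (c * s `^ a)))%:E)%E) ->
  P [set w | X w <= 0] = 0%E.
Proof.
move=> a0 c0 mX lapX.
have mA := measurable_le_fun 0 mX.
apply/eqP; rewrite eq_le measure_ge0 andbT.
apply/lee_addgt0Pr => e e0; rewrite add0e.
pose s := (c * e)^-1 `^ a^-1.
have ce0 : 0 < (c * e)^-1 by rewrite invr_gt0 mulr_gt0.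
have s0 : 0 < s by rewrite powR_gt0.
apply: (@le_trans _ _ (expR (- (c * s `^ a)))%:E); last first.
  rewrite lee_fin /s -powRrM mulVf ?gt_eqF// powRr1 ?(ltW ce0)//.
  have -> : c * (c * e)^-1 = e^-1 by field; rewrite !gt_eqF.
  rewrite expRN invf_ple ?posrE ?expR_gt0//.
  by apply: le_trans (expR_ge1Dx _); rewrite lerDr.
rewrite -lapX// -(setIT [set w | X w <= 0]) -integral_indic//.
apply: ge0_le_integral => //.
- by apply/measurable_EFinP; exact: measurable_indic.
- apply/measurable_EFinP; under eq_fun do rewrite -mulNr; exact: measurable_expRM.
- move=> w _; rewrite lee_fin indicE; have [/set_mem/= Xw|_] := boolP (_ \in _).
    by rewrite -[leLHS]expR0 ler_expR oppr_ge0 mulr_ge0_le0// ltW.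
  exact: expR_ge0.
Qed.

(** A polynomial in [expR (- (s * X))] only sees the Laplace transform at the
    multiples of [s]. *)
Lemma integral_horner_laplace (X : T -> R) (phi : R -> R) (s : R) (p : {poly R}) :
  0 < s -> measurable_fun setT X ->
  (forall s, 0 < s -> (\int[P]_w (expR (- (s * X w)))%:E = (phi s)%:E)%E) ->
  (\int[P]_w (p.[expR (- (s * X w))])%:E =
   (\sum_(i < size p) p`_i * (if i == 0 :> nat then 1 else phi (i%:R * s)))%:E)%E.
Proof.
move=> s0 mX lapX.
have int_i (i : nat) : (\int[P]_w (expR (- (s * X w)) ^+ i)%:E =
    (if i == 0%N then 1 else phi (i%:R * s))%:E)%E.
  have [->|i0] := eqVneq i 0%N.
    by under eq_integral do rewrite expr0; rewrite integral_cst//= probability_setT mule1.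
  rewrite -lapX ?mulr_gt0 ?ltr0n ?lt0n//; apply: eq_integral => w _.
  by rewrite -expRM_natl mulrN mulrA.
have mi (i : nat) : measurable_fun setT (fun w => expR (- (s * X w)) ^+ i).
  by apply: measurable_funX; under eq_fun do rewrite -mulNr; exact: measurable_expRM.
have inti (i : nat) : P.-integrable setT (fun w => (expR (- (s * X w)) ^+ i)%:E).
  apply/integrableP; split; first exact/measurable_EFinP.
  under eq_integral do rewrite gee0_abs ?lee_fin ?exprn_ge0 ?expR_ge0//.
  by rewrite int_i ltry.
under eq_integral do rewrite horner_coef -sumEFin.
rewrite integral_sum//; last first.
  by move=> i; under eq_fun do rewrite EFinM; exact: integrableZl.
rewrite -sumEFin; apply: eq_bigr => i _.
under eq_integral do rewrite EFinM.
by rewrite integralZl// int_i EFinM.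
Qed.

(** With [s = ln 2 / t], the event [t < X] is [expR (- (s * X)) < 1/2], whose
    indicator is the bounded limit of the step polynomials. *)
Lemma laplace_tail_cvg (X : T -> R) (t : R) :
  0 < t -> measurable_fun setT X -> P [set w | X w <= 0] = 0%E ->
  (\int[P]_w ((step_poly m).[expR (- (ln 2 / t * X w))])%:E)%E @[m --> \oo] -->
  P [set w | t < X w].
Proof.
move=> t0 mX X0.
have mA := measurable_gt_fun t mX.
have ln2 : 0 < ln 2 :> R by rewrite ln_gt0// ltr1n.
have s0 : 0 < ln 2 / t by rewrite divr_gt0.
have aeX : {ae P, forall w, 0 < X w}.
  exists [set w | X w <= 0]; split => //; first exact: measurable_le_fun.
  by move=> w /=; rewrite real_leNgt ?num_real// => /negP.
have e01 w : 0 < X w -> 0 <= expR (- (ln 2 / t * X w)) <= 1.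
  move=> Xw; rewrite expR_ge0/= -[leRHS]expR0 ler_expR oppr_le0 mulr_ge0// ltW//.
have -> : P [set w | t < X w] = (\int[P]_w (\1_[set w | t < X w] w)%:E)%E.
  by rewrite integral_indic// setIT.
have mE : measurable_fun setT (fun w => expR (- (ln 2 / t * X w))).
  by under eq_fun do rewrite -mulNr; exact: measurable_expRM.
have [//|||||] := @dominated_convergence _ T R P setT measurableT
  (fun m w => ((step_poly m).[expR (- (ln 2 / t * X w))])%:E)
  (fun w => (\1_[set w | t < X w] w)%:E) (cst 1%E).
- move=> m; apply/measurable_EFinP.
  have : measurable_fun setT (horner (step_poly m : {poly R})).
    by apply: continuous_measurable_fun; exact: continuous_horner.
  by move=> mh; exact: (measurableT_comp mh mE).
- by apply/measurable_EFinP; exact: measurable_indic.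
- apply: filterS aeX => w Xw _; apply/fine_cvgP; split; first exact: nearW.
  have -> : \1_[set w | t < X w] w = (expR (- (ln 2 / t * X w)) < 2^-1)%R%:R :> R.
    rewrite indicE; congr ((nat_of_bool _)%:R); have -> : 2^-1 = expR (- ln 2) :> R.
      by rewrite expRN lnK// posrE.
    rewrite ltr_expR ltrN2 mulrAC ltr_pdivlMr// ltr_pM2l//.
    by apply/idP/idP; rewrite inE.
  exact: (cvg_step_poly (e01 _ Xw)).
- apply/integrableP; split => //.
  by rewrite integral_cst//= normr1 mul1e probability_setT ltry.
- apply: filterS aeX => w Xw m _; rewrite /= lee_fin.
  by have /andP[h1 h2] := step_poly_itv m (e01 _ Xw); rewrite ger0_norm.
- by [].
Qed.

(** The step polynomials have the same integrals for both variables, hence so do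
    their limits, the indicators; at [t = 0] positivity is enough. *)
Lemma laplace_tail_eq (X X' : T -> R) (phi : R -> R) (t : R) :
  0 <= t -> measurable_fun setT X -> measurable_fun setT X' ->
  P [set w | X w <= 0] = 0%E -> P [set w | X' w <= 0] = 0%E ->
  (forall s, 0 < s -> (\int[P]_w (expR (- (s * X w)))%:E = (phi s)%:E)%E) ->
  (forall s, 0 < s -> (\int[P]_w (expR (- (s * X' w)))%:E = (phi s)%:E)%E) ->
  P [set w | t < X w] = P [set w | t < X' w].
Proof.
rewrite le_eqVlt => /predU1P[<-|t0] mX mX' X0 X'0 lapX lapX'.
  have gt0E (Z : T -> R) : measurable_fun setT Z -> P [set w | Z w <= 0] = 0%E ->
      P [set w | 0 < Z w] = 1%E.
    move=> mZ Z0; rewrite -[RHS]sube0 -Z0 -probability_setC; last exact: measurable_le_fun.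
    congr (P _); apply/seteqP; split => w /=.
      by rewrite real_ltNge ?num_real// => /negP.
    by move/negP; rewrite -real_ltNge ?num_real.
  by rewrite !gt0E.
have s0 : 0 < ln 2 / t by rewrite divr_gt0 ?ln_gt0// ltr1n.
have := @laplace_tail_cvg X t t0 mX X0.
under eq_fun do rewrite (integral_horner_laplace _ s0 mX lapX).
under eq_fun do rewrite -(integral_horner_laplace _ s0 mX' lapX').
by move/cvg_unique; apply; [exact: ereal_hausdorff|exact: laplace_tail_cvg].
Qed.

Lemma eq_tail_integral (X Y : T -> R) (g : R -> \bar R) :
  measurable_fun setT X -> measurable_fun setT Y ->
  (forall t, P [set w | t < X w] = P [set w | t < Y w]) ->
  measurable_fun setT g -> (forall x, 0 <= g x)%E ->
  (\int[P]_w g (X w) = \int[P]_w g (Y w))%E.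
Proof.
move=> mX mY tailE mg g0.
pose X' : {RV P >-> R} := HB.pack X (isMeasurableFun.Build _ _ _ _ _ mX).
pose Y' : {RV P >-> R} := HB.pack Y (isMeasurableFun.Build _ _ _ _ _ mY).
rewrite -[LHS](ge0_integral_distribution X')// -[RHS](ge0_integral_distribution Y')//.
apply: eq_measure_integral => A mA _.
apply: (@measure_unique _ R R (@RGenOInfty.G R) (fun n => `](- n%:R), +oo[%classic)) => //.
- exact: RGenOInfty.measurableE.
- move=> _ _ [x ->] [y ->]; exists (Num.max x y).
  by apply/seteqP; split => z /=; rewrite !in_itv/= !andbT gt_max => /andP.
- by move=> n; exists (- n%:R).
- apply/seteqP; split => // z _; exists (Num.bound `|z|) => //=.
  by rewrite in_itv/= andbT ltrNl (le_lt_trans (ler_norm _))// normrN archi_boundP.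
- move=> _ [x ->]; have := tailE x; rewrite /= /distribution /pushforward/=.
  by congr (P _ = P _); apply/seteqP; split => w /=; rewrite in_itv/= andbT.
- by move=> n; rewrite (le_lt_trans (probability_le1 _ _))// ltry.
Qed.

(** The gap between strict and weak inequality disappears on writing [t < Y] as
    the increasing union of the events [t + n.+1%:R^-1 < Y]. *)
Lemma le_tail_sandwich (Y W : T -> R) :
  measurable_fun setT Y -> measurable_fun setT W ->
  (forall r : R, 0 < r ->
    (P [set w | (r < Y w)%R] <= P [set w | (r <= W w)%R])%E) ->
  forall t : R, 0 <= t -> (P [set w | (t < Y w)%R] <= P [set w | (t < W w)%R])%E.
Proof.
move=> mY mW YW t t0.
pose F n := [set w | t + n.+1%:R^-1 < Y w].
have -> : [set w | t < Y w] = \bigcup_n F n.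
  apply/seteqP; split => w /=; last first.
    by move=> [n _]; rewrite /F/=; apply: lt_trans; rewrite ltrDl invr_gt0.
  by move=> tY; have /ltr_add_invr[n tn] := tY; exists n.
have cF : P (F n) @[n --> \oo] --> P (\bigcup_n F n).
  apply: nondecreasing_cvg_mu.
  - by move=> n; exact: measurable_gt_fun.
  - by apply: bigcup_measurable => n _; exact: measurable_gt_fun.
  - move=> n m nm; apply/subsetPset => w /=; apply: le_lt_trans.
    by rewrite lerD2l lef_pV2 ?posrE// ler_nat ltnS.
rewrite -(cvg_lim _ cF)//; apply: lime_le; first by apply/cvg_ex; eexists; exact: cF.
apply: nearW => n; apply: le_trans (YW _ _) _; first by rewrite ltr_wpDl// invr_gt0.
apply: le_measure; rewrite ?inE; [exact: measurable_ge_fun|exact: measurable_gt_fun|].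
by move=> w /=; apply: lt_le_trans; rewrite ltrDl invr_gt0.
Qed.

End LaplaceTransform.

(** * The inverse stable subordinator *)

Section InverseStable.
Context d (T : measurableType d) (R : realType) (P : probability T R).
Implicit Types (D Y : R -> T -> R) (a r s t : R).

Lemma le_measure_ae (A B : set T) : measurable A -> measurable B ->
  {ae P, forall w, A w -> B w} -> (P A <= P B)%E.
Proof.
move=> mA mB [N [mN N0 AB]].
apply: (@le_trans _ _ (P (B `|` N))).
  apply: le_measure; rewrite ?inE//; first exact: measurableU.
  move=> w Aw; have [Bw|nBw] := pselect (B w); [by left|right].
  by apply: AB => /= /(_ Aw).
by rewrite (le_trans (measureU2 _ _ _))// [X in (_ + X)%E]N0 adde0.
Qed.

Lemma stable_laplace a D r s : stable_subordinator P a D -> 0 <= r -> 0 < s ->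
  (\int[P]_w (expR (- (s * D r w)))%:E = (expR (- (r * s `^ a)))%:E)%E.
Proof. by move=> [_ _ lapD] r0 s0; have := lapD s r s0 r0; rewrite unlock. Qed.

Lemma stable_measurable a D r : stable_subordinator P a D -> 0 <= r ->
  measurable_fun setT (D r).
Proof. by move=> [[mD _ _ _ _] _ _]; exact: mD. Qed.

Lemma stable_null_le0 a D r : 0 < a -> stable_subordinator P a D -> 0 < r ->
  P [set w | D r w <= 0] = 0%E.
Proof.
move=> a0 sD r0; apply: (laplace_null_le0 a0 r0).
  by apply: (stable_measurable sD); exact: ltW.
by move=> s s0; rewrite (stable_laplace sD)// ltW.
Qed.

(** Self-similarity: both sides have the Laplace transform
    [expR (- (r * s `^ a))]. *)
Lemma stable_tail_scaling a D r t : 0 < a -> stable_subordinator P a D ->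
  0 < r -> 0 <= t ->
  P [set w | t < D r w] = P [set w | t < D 1 w * r `^ a^-1].
Proof.
move=> a0 sD r0 t0; have rV0 : 0 < r `^ a^-1 by rewrite powR_gt0.
apply: (@laplace_tail_eq _ _ _ P _ _ (fun s => expR (- (r * s `^ a))) t t0).
- by apply: (stable_measurable sD); exact: ltW.
- by apply: measurable_funM => //; exact: (stable_measurable sD).
- exact: (stable_null_le0 a0).
- rewrite -[RHS](stable_null_le0 a0 sD ltr01); congr (P _).
  by apply/seteqP; split => w /=; rewrite pmulr_lle0.
- by move=> s s0; apply: (stable_laplace sD) => //; exact: ltW.
- move=> s s0; transitivity (\int[P]_w (expR (- ((s * r `^ a^-1) * D 1 w)))%:E)%E.
    by apply: eq_integral => w _; rewrite mulrA mulrAC.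
  rewrite (stable_laplace sD)// ?mulr_gt0// mul1r powRM ?(ltW s0) ?powR_ge0//.
  by rewrite -powRrM mulVf ?gt_eqF// powRr1 ?(ltW r0)// mulrC.
Qed.

(** Integrate [euler_integral_scale] at [x = D 1 w]. After the exchange of the
    integrals the Laplace transform at [r `^ a^-1] appears, which is [expR (- r)],
    and the integral in [r] is a factorial. *)
Lemma stable_moment a D n : 0 < a -> stable_subordinator P a D ->
  (\int[P]_w (((D 1 w `^ a)^-1) ^+ n)%:E = (n`!%:R / Gamma (n%:R * a + 1))%:E)%E.
Proof.
move=> a0 sD; have mD1 := stable_measurable sD ler01.
have mV m : measurable_fun setT (fun w => (D 1 w `^ a)^-1 ^+ m).
  apply: measurable_funX; under eq_fun do rewrite -powRN.
  exact: (measurableT_comp (measurable_powR (- a))).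
have V0 w : 0 <= (D 1 w `^ a)^-1 by rewrite invr_ge0 powR_ge0.
case: n => [|n].
  under eq_integral do rewrite expr0.
  by rewrite integral_cst//= probability_setT mule1 mul0r (Gamma_nat 0) divr1.
have na0 : 0 <= n.+1%:R * a by rewrite mulr_ge0// ltW.
have G0 := Gamma_gt0 na0.
pose f (p : T * R) : R := \1_`]0, +oo[ p.2 *
  (n.+1%:R * p.2 ^+ n * expR (- (D 1 p.1 * p.2 `^ a^-1))).
have f0 p : (0 <= (f p)%:E)%E.
  rewrite lee_fin /f indicE; have [/set_mem/=|_] := boolP (p.2 \in _); last by rewrite mul0r.
  by rewrite in_itv/= andbT => r0; rewrite mul1r !mulr_ge0 ?exprn_ge0 ?expR_ge0// ltW.
have mf : measurable_fun setT (EFin \o f).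
  apply/measurable_EFinP; apply: measurable_funM.
    have m1 : measurable_fun setT (\1_`]0, +oo[ : R -> R) by exact: measurable_indic.
    exact: (measurableT_comp m1 measurable_snd).
  apply: measurable_funM.
    by apply: measurable_funM => //; apply: measurable_funX; exact: measurable_snd.
  apply: measurableT_comp => //; apply: measurableT_comp; first exact: oppr_measurable.
  apply: measurable_funM; first exact: (measurableT_comp mD1 measurable_fst).
  exact: (measurableT_comp (measurable_powR a^-1) measurable_snd).
have fE w r : f (w, r) =
    ((fun r => n.+1%:R * r ^+ n * expR (- (D 1 w * r `^ a^-1))) \_ `]0, +oo[) r.
  by rewrite /f patchE/= indicE; case: ifPn; rewrite ?mul1r ?mul0r.
have scale w : 0 < D 1 w -> (euler_integral (n.+1%:R * a) * ((D 1 w `^ a)^-1 ^+ n.+1)%:E =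
    \int[lebesgue_measure]_r (f (w, r))%:E)%E.
  move=> D0; rewrite euler_integral_scale// integral_mkcond; apply: eq_integral => r _.
  by rewrite fE/= !patchE; case: ifPn.
have e_fin := euler_integral_fin_num na0.
suff : (euler_integral (n.+1%:R * a) * \int[P]_w ((D 1 w `^ a)^-1 ^+ n.+1)%:E =
    n.+1`!%:R%:E)%E.
  rewrite -(fineK e_fin) -GammaE => /(congr1 (fun x => (Gamma (n.+1%:R * a + 1))^-1%:E * x)%E).
  by rewrite muleA -EFinM mulVf ?gt_eqF// mul1e => ->; rewrite -EFinM mulrC.
rewrite -ge0_integralZl//; last 3 first.
- exact/measurable_EFinP.
- by move=> w _; rewrite lee_fin exprn_ge0.
- exact: euler_integral_ge0.
rewrite (@ge0_ae_eq_integral _ _ _ _ _ _ (fun w => \int[lebesgue_measure]_r (f (w, r))%:E)%E)//;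
  last 5 first.
- by apply: measurable_funeM; exact/measurable_EFinP.
- exact: (@measurable_fun_fubini_tonelli_F _ _ _ _ R lebesgue_measure (EFin \o f) mf).
- by move=> w _; rewrite mule_ge0 ?euler_integral_ge0// lee_fin exprn_ge0.
- by move=> w _; apply: integral_ge0 => r _.
- exists [set w | D 1 w <= 0]; split.
  + exact: measurable_le_fun.
  + exact: (stable_null_le0 a0 sD).
  + by move=> w /=; rewrite real_leNgt ?num_real// => h; apply/negP => /scale Dw; apply: h.
rewrite (@fubini_tonelli _ _ _ _ R P lebesgue_measure (EFin \o f) mf f0)/=.
transitivity (\int[lebesgue_measure]_(r in `]0%R, +oo[)
    (n.+1%:R * r ^+ n * expR (- (1 * r `^ 1^-1)) : R)%:E)%E.
  rewrite [RHS]integral_mkcond; apply: eq_integral => r _.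
  under eq_integral do rewrite fE.
  rewrite patchE; case: ifPn => [rI|rI].
    have r0 : 0 < r by move: rI; rewrite inE/= in_itv/= andbT.
    under eq_integral do rewrite patchE rI EFinM.
    rewrite ge0_integralZl//.
    + under eq_integral do rewrite mulrC.
      rewrite (stable_laplace sD)// ?powR_gt0// invr1 powRr1 ?(ltW r0)// !mul1r.
      by rewrite -powRrM mulVf ?gt_eqF// powRr1 ?(ltW r0)// EFinM.
    + apply/measurable_EFinP; under eq_fun do rewrite -mulrN mulrC.
      exact: measurable_expRM.
    + by rewrite lee_fin mulr_ge0// exprn_ge0// ltW.
  by apply: integral0_eq => w _; rewrite patchE (negbTE rI).
rewrite -euler_integral_scale// mulr1 powR1 invr1 expr1n mule1.
exact: euler_integral_nat.
Qed.

End InverseStable.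

Section InverseStableLaw.
Context d (T : measurableType d) (R : realType) (P : probability T R).
Implicit Types (D Y : R -> T -> R) (a r s t : R).

(** Chernoff bound with parameter 1. *)
Lemma stable_le_tail a D r t : 0 < a -> stable_subordinator P a D -> 0 <= r ->
  (P [set w | (D r w <= t)%R] <= (expR (t - r))%:E)%E.
Proof.
move=> a0 sD r0; have mDr := stable_measurable sD r0.
have mA := measurable_le_fun t mDr.
have -> : (expR (t - r))%:E = (\int[P]_w ((expR t)%:E * (expR (- (1 * D r w)))%:E))%E.
  rewrite ge0_integralZl//.
  - by rewrite (stable_laplace sD)// powR1 mulr1 -EFinM -expRD.
  - by apply/measurable_EFinP; under eq_fun do rewrite -mulNr; exact: measurable_expRM.
rewrite -(setIT [set w | _]) -integral_indic//.
apply: ge0_le_integral => //.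
- by apply/measurable_EFinP; exact: measurable_indic.
- apply: measurable_funeM; apply/measurable_EFinP; under eq_fun do rewrite -mulNr.
  exact: measurable_expRM.
- move=> w _; rewrite -EFinM lee_fin indicE -expRD mul1r.
  have [/set_mem/= Xw|_] := boolP (_ \in _); last exact: expR_ge0.
  by rewrite -[leLHS]expR0 ler_expR subr_ge0.
Qed.

(** Almost surely the infimum that defines the inverse is not the infimum of
    the empty set. *)
Lemma stable_ae_unbounded a D t : 0 < a -> stable_subordinator P a D ->
  {ae P, forall w, exists2 r, 0 <= r & t < D r w}.
Proof.
move=> a0 sD; exists (\bigcap_n [set w | D n%:R w <= t]).
have mA n : measurable [set w | D n%:R w <= t].
  by apply: measurable_le_fun; exact: (stable_measurable sD).
have mB : measurable (\bigcap_n [set w | D n%:R w <= t]) by exact: bigcapT_measurable.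
split => //.
- apply/eqP; rewrite eq_le measure_ge0 andbT.
  apply/lee_addgt0Pr => e e0; rewrite add0e.
  pose n := Num.bound `|t - ln e|.
  apply: (@le_trans _ _ (P [set w | D n%:R w <= t])).
    by apply: le_measure; rewrite ?inE// => w; exact.
  apply: le_trans (stable_le_tail t a0 sD (ler0n _ n)) _.
  rewrite lee_fin -[leRHS]lnK ?posrE// ler_expR lerBlDr addrC -lerBlDr.
  by rewrite (le_trans (ler_norm _))// ltW// archi_boundP.
- move=> w /= h n _ /=; rewrite leNgt; apply/negP => tD.
  by apply: h; exists n%:R.
Qed.

(** By self-similarity the inverse at time [t] has the law of [(t / D 1) `^ a], a
    variable with explicit moments. *)
Definition inverse_stable_repr a D t w := t `^ a * (D 1 w `^ a)^-1.

Lemma measurable_inverse_stable_repr a D t : stable_subordinator P a D ->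
  measurable_fun setT (inverse_stable_repr a D t).
Proof.
move=> sD; apply: measurable_funM => //; under eq_fun do rewrite -powRN.
exact: (measurableT_comp (measurable_powR (- a)) (stable_measurable sD ler01)).
Qed.

Lemma inverse_stable_repr_tail a D r t : 0 < a -> stable_subordinator P a D ->
  0 < r -> 0 <= t ->
  P [set w | D r w <= t] = P [set w | r <= inverse_stable_repr a D t w].
Proof.
move=> a0 sD r0 t0.
have mDr := stable_measurable sD (ltW r0); have mD1 := stable_measurable sD ler01.
have mDr1 : measurable_fun setT (fun w => D 1 w * r `^ a^-1) by exact: measurable_funM.
have mW := measurable_inverse_stable_repr t sD.
have leE (Z : T -> R) : measurable_fun setT Z ->
    P [set w | Z w <= t] = (1 - P [set w | (t < Z w)%R])%E.
  move=> mZ; rewrite -probability_setC; last exact: measurable_gt_fun.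
  by congr (P _); apply/seteqP; split => w /=; rewrite real_leNgt ?num_real// => /negP.
rewrite leE// (stable_tail_scaling a0 sD)// -leE//.
have mW' : measurable [set w | r <= inverse_stable_repr a D t w].
  exact: measurable_ge_fun.
have aeD : {ae P, forall w, 0 < D 1 w}.
  exists [set w | D 1 w <= 0]; split; first exact: measurable_le_fun.
  - exact: (stable_null_le0 a0 sD).
  - by move=> w /=; rewrite real_leNgt ?num_real// => /negP.
apply/eqP; rewrite eq_le; apply/andP; split; apply: le_measure_ae => //.
- exact: measurable_le_fun.
- by apply: filterS aeD => w D0 /=; rewrite (powR_swap a0 D0 t0 (ltW r0)).
- exact: measurable_le_fun.
- by apply: filterS aeD => w D0 /=; rewrite (powR_swap a0 D0 t0 (ltW r0)).
Qed.

Lemma inverse_stable_ge0 a Y t w : 0 <= t -> inverse_stable_subordinator P a Y ->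
  0 <= Y t w.
Proof.
move=> t0 [D [_ _ ->//]].
have [->|/set0P ne] := eqVneq [set r | 0 <= r /\ t < D r w] set0; first by rewrite inf0.
by apply: lb_le_inf => // r [].
Qed.

(** For nondecreasing unbounded paths, [r < Y] implies [D r <= t], which implies
    [r <= Y]; and [D r <= t] is as likely as [r <= inverse_stable_repr]. *)
Lemma inverse_stable_tail a Y t : 0 < a -> 0 <= t -> inverse_stable_subordinator P a Y ->
  exists2 D, stable_subordinator P a D & forall x,
    P [set w | x < Y t w] = P [set w | x < inverse_stable_repr a D t w].
Proof.
move=> a0 t0 iY; have Y0 w := inverse_stable_ge0 w t0 iY.
have [D [sD mY YE]] := iY; exists D => //.
have {}mY : measurable_fun setT (Y t) by exact: mY.
have {}YE w : Y t w = inf [set r | 0 <= r /\ t < D r w] by exact: YE.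
have mW := measurable_inverse_stable_repr t sD.
have lb0 w : lbound [set r | 0 <= r /\ t < D r w] 0 by move=> r [].
have W0 w : 0 <= inverse_stable_repr a D t w by rewrite mulr_ge0 ?invr_ge0 ?powR_ge0.
move=> x; have [x0|x0] := ltP x 0.
  by congr (P _); apply/seteqP; split => w _ /=; exact: lt_le_trans x0 _.
apply/eqP; rewrite eq_le; apply/andP; split; apply: le_tail_sandwich => // r r0.
- rewrite -(inverse_stable_repr_tail a0 sD r0 t0); apply: le_measure.
  + by rewrite inE; exact: measurable_gt_fun.
  + by rewrite inE; apply: measurable_le_fun; apply: (stable_measurable sD); exact: ltW.
  + move=> w /=; rewrite YE; apply: contraPP => /negP; rewrite -real_ltNge ?num_real// => tD.
    apply/negP; rewrite -leNgt; apply: ge_inf; first by exists 0; exact: lb0.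
    by split => //; exact: ltW.
- apply: (@le_trans _ _ (P [set w | (r <= inverse_stable_repr a D t w)%R])).
    apply: le_measure; rewrite ?inE; [exact: measurable_gt_fun|exact: measurable_ge_fun|].
    by move=> w /=; exact: ltW.
  rewrite -(inverse_stable_repr_tail a0 sD r0 t0); apply: le_measure_ae.
  + by apply: measurable_le_fun; apply: (stable_measurable sD); exact: ltW.
  + exact: measurable_ge_fun.
  + have [_ mono _] := sD.
    have unb := stable_ae_unbounded t a0 sD.
    apply: filterS2 mono unb => w mono [s s0 tD] /= Dr.
    rewrite YE; apply: lb_le_inf; first by exists s.
    move=> q [q0 tDq]; rewrite leNgt; apply/negP => qr.
    by have := le_trans (mono _ _ q0 (ltW qr)) Dr; rewrite leNgt tDq.
Qed.

(** Dominated convergence for the partial sums of the exponential series, the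
    dominating function being the exponential of the absolute values. *)
Lemma integral_expR_moments (W : T -> R) (M : nat -> R) (m : R) :
  measurable_fun setT W -> (forall w, 0 <= W w) ->
  (forall n, (\int[P]_w (W w ^+ n)%:E = (M n)%:E)%E) ->
  cvgn (series (fun n => `|m| ^+ n * M n / n`!%:R)) ->
  (\int[P]_w (expR (m * W w))%:E =
    (limn (series (fun n => m ^+ n * M n / n`!%:R)))%:E)%E.
Proof.
move=> mW W0 WM cM.
have M0 n : 0 <= M n.
  by rewrite -lee_fin -WM; apply: integral_ge0 => w _; rewrite lee_fin exprn_ge0.
have mWn n : measurable_fun setT (fun w => W w ^+ n) by exact: measurable_funX.
have iW n : P.-integrable setT (fun w => (W w ^+ n)%:E).
  apply/integrableP; split; first exact/measurable_EFinP.
  under eq_integral do rewrite gee0_abs ?lee_fin ?exprn_ge0//.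
  by rewrite WM ltry.
pose f (c : R) n w : R := series (exp_coeff (c * W w)) n.
have fE c n w : f c n w = \sum_(0 <= i < n) (c ^+ i / i`!%:R) * W w ^+ i.
  by rewrite /f /series/=; apply: eq_bigr => i _; rewrite /exp_coeff/= exprMn mulrAC.
have mf c n : measurable_fun setT (f c n).
  rewrite (_ : f c n = fun w => \sum_(0 <= i < n) (c ^+ i / i`!%:R) * W w ^+ i); last first.
    by apply/funext => w; exact: fE.
  apply: measurable_sum => i.
  exact: measurable_funM.
have intf c n : (\int[P]_w (f c n w)%:E =
    (series (fun n => c ^+ n * M n / n`!%:R) n)%:E)%E.
  under eq_integral do rewrite fE -sumEFin.
  rewrite integral_sum//; last first.
    by move=> i; under eq_fun do rewrite EFinM; exact: integrableZl.
  rewrite /series/= -sumEFin; apply: eq_bigr => i _.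
  under eq_integral do rewrite EFinM.
  by rewrite integralZl// WM -EFinM mulrAC.
have cf c w : f c n w @[n --> \oo] --> expR (c * W w) by exact: is_cvg_series_exp_coeff.
have mexp c : measurable_fun setT (fun w => expR (c * W w)) by exact: measurable_expRM.
have f_ge0 n w : 0 <= f `|m| n w.
  by rewrite fE sumr_ge0// => i _; rewrite mulr_ge0 ?exprn_ge0// mulr_ge0 ?exprn_ge0// invr_ge0.
have f_le n w : f `|m| n w <= expR (`|m| * W w).
  apply: nondecreasing_cvgn_le; last exact: is_cvg_series_exp_coeff.
  apply/nondecreasing_seqP => k; rewrite /series/= big_nat_recr//= lerDl.
  by rewrite divr_ge0// exprn_ge0// mulr_ge0.
have dom_fin : (\int[P]_w (expR (`|m| * W w))%:E <=
    (limn (series (fun n => `|m| ^+ n * M n / n`!%:R)))%:E)%E.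
  apply: (@ge0_fatou_cvg _ _ _ P (fun n w => (f `|m| n w)%:E) _
    (fun n => (series (fun n => `|m| ^+ n * M n / n`!%:R) n)%:E)).
  - by move=> n; apply/measurable_EFinP.
  - exact/measurable_EFinP.
  - by move=> n w; rewrite lee_fin.
  - by move=> w; rewrite lee_fin expR_ge0.
  - by apply: aeW => w; apply/fine_cvgP; split; [exact: nearW|exact: cf].
  - by move=> n; rewrite intf.
  - by apply/fine_cvgP; split; [exact: nearW|exact: cM].
have [|||||] := @dominated_convergence _ T R P setT measurableT
  (fun n w => (f m n w)%:E) (fun w => (expR (m * W w))%:E)
  (fun w => (expR (`|m| * W w))%:E).
- by move=> n; apply/measurable_EFinP.
- exact/measurable_EFinP.
- by apply: aeW => w _; apply/fine_cvgP; split; [exact: nearW|exact: cf].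
- apply/integrableP; split; first exact/measurable_EFinP.
  under eq_integral do rewrite gee0_abs ?lee_fin ?expR_ge0//.
  by rewrite (le_lt_trans dom_fin)// ltry.
- apply: aeW => w n _ /=; rewrite lee_fin (le_trans _ (f_le n w))// !fE.
  apply: le_trans (ler_norm_sum _ _ _) _; apply: ler_sum => i _.
  by rewrite !normrM normrX normrV ?unitfE// normr_nat (ger0_norm (exprn_ge0 _ (W0 w))).
move=> _ _; under eq_fun do rewrite intf.
move/cvg_unique; apply; first exact: ereal_hausdorff.
apply/fine_cvgP; split; first exact: nearW.
apply: normed_cvg.
rewrite (_ : [normed _] = series (fun n => `|m| ^+ n * M n / n`!%:R))//.
congr series; apply/funext => n /=.
by rewrite !normrM normrX normrV ?unitfE// normr_nat (ger0_norm (M0 n)).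
Qed.

(** The moments [(t `^ a) ^+ n * n! / Gamma (n * a + 1)] cancel the factorials of the
    exponential series, which leaves the Mittag-Leffler series. *)
Lemma inverse_stable_mgf a Y t (m : R) : 0 < a -> 0 <= t ->
  inverse_stable_subordinator P a Y ->
  (\int[P]_w (expR (m * Y t w))%:E = (mittag_leffler a (m * t `^ a))%:E)%E.
Proof.
move=> a0 t0 iY; have [D sD tailE] := inverse_stable_tail a0 t0 iY.
have [_ [_ mY _]] := iY.
have mW := measurable_inverse_stable_repr t sD.
have mexp : measurable_fun setT (fun x => (expR (m * x))%:E).
  by apply/measurable_EFinP; exact: (@measurable_expRM _ _ _ id).
rewrite (@eq_tail_integral _ _ _ P (Y t) _ (fun x => (expR (m * x))%:E) (mY _ t0) mW tailE mexp)//.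
have ta0 : 0 <= t `^ a by exact: powR_ge0.
rewrite (@integral_expR_moments _ (fun n => (t `^ a) ^+ n * (n`!%:R / Gamma (n%:R * a + 1))))//.
- rewrite /mittag_leffler; congr (limn (series _))%:E; apply/funext => n.
  rewrite exprMn; field; rewrite pnatr_eq0 -lt0n fact_gt0 andbT gt_eqF// Gamma_gt0//.
  by rewrite mulr_ge0// ltW.
- by move=> w; rewrite mulr_ge0 ?invr_ge0 ?powR_ge0.
- move=> n; rewrite EFinM -(stable_moment n a0 sD) -ge0_integralZl//.
  + by apply: eq_integral => w _; rewrite exprMn EFinM.
  + apply/measurable_EFinP; apply: measurable_funX; under eq_fun do rewrite -powRN.
    exact: (measurableT_comp (measurable_powR (- a)) (stable_measurable sD ler01)).
  + by move=> w _; rewrite lee_fin exprn_ge0// invr_ge0 powR_ge0.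
  + by rewrite lee_fin exprn_ge0.
- rewrite (_ : (fun n => _) = (fun n => `|m * t `^ a| ^+ n / Gamma (n%:R * a + 1))).
    exact: normed_mittag_leffler_cvg.
  apply/funext => n; rewrite normrM (ger0_norm ta0) exprMn; field.
  rewrite pnatr_eq0 -lt0n fact_gt0 andbT gt_eqF// Gamma_gt0//.
  by rewrite mulr_ge0// ltW.
Qed.

End InverseStableLaw.

(** * Poisson and Skellam processes of order k *)

Section CompoundSums.
Context d (T : measurableType d) (R : realType) (P : probability T R).
Local Open Scope ereal_scope.

Lemma sigma_family_preimage (I : Type) d' (U : measurableType d') (D : set I)
    (X : I -> T -> U) i (B : set U) :
  D i -> measurable B -> sigma_family D X (X i @^-1` B).
Proof.
move=> Di mB; apply: sub_sigma_algebra; exists i => //.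
by exists B => //; rewrite setTI.
Qed.

Definition partial_sum (X : nat -> T -> nat) n w := (\sum_(i < n) X i w)%N.

Lemma partial_sumS X n w : partial_sum X n.+1 w = (partial_sum X n w + X n w)%N.
Proof. by rewrite /partial_sum big_ord_recr. Qed.

Lemma sigma_family_partial_sum (X : nat -> T -> nat) n (B : set nat) :
  sigma_family setT X (partial_sum X n @^-1` B).
Proof.
pose G := \bigcup_(i in [set: nat]) preimage_set_system setT (X i) measurable.
have mX i : measurable_fun (setT : set (g_sigma_algebraType G)) (X i).
  move=> _ C mC; rewrite setTI; exact: sigma_family_preimage.
have mS : measurable_fun (setT : set (g_sigma_algebraType G)) (partial_sum X n).
  elim: n => [|n IH].
    by rewrite (_ : partial_sum X 0 = cst 0%N)//; apply/funext => w; rewrite /partial_sum big_ord0.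
  rewrite (_ : partial_sum X n.+1 = fun w => (partial_sum X n w + X n w)%N); last first.
    by apply/funext => w; exact: partial_sumS.
  exact: measurable_fun_addn.
by have := mS measurableT B I; rewrite setTI.
Qed.

Lemma measurable_partial_sum (X : nat -> T -> nat) n :
  (forall i, measurable_fun setT (X i)) -> measurable_fun setT (partial_sum X n).
Proof.
move=> mX; elim: n => [|n IH].
  by rewrite (_ : partial_sum X 0 = cst 0%N)//; apply/funext => w; rewrite /partial_sum big_ord0.
rewrite (_ : partial_sum X n.+1 = fun w => (partial_sum X n w + X n w)%N); last first.
  by apply/funext => w; exact: partial_sumS.
exact: measurable_fun_addn.
Qed.

(** The masses of [1], ..., [k] already add up to 1. *)
Lemma uniform_null k (X : T -> nat) j : (1 <= k)%N -> measurable_fun setT X ->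
  (forall j, (1 <= j <= k)%N -> P [set w | X w = j] = (k%:R^-1)%:E) ->
  ~~ (1 <= j <= k)%N -> P [set w | X w = j] = 0.
Proof.
move=> k1 mX unif jk.
have mA i : measurable [set w | X w = i] by exact: (@measurable_preimage _ _ _ _ X [set i]).
have mB m : measurable [set w | (1 <= X w <= m)%N].
  exact: (@measurable_preimage _ _ _ _ X [set i | (1 <= i <= m)%N]).
have PB m : (m <= k)%N -> P [set w | (1 <= X w <= m)%N] = (m%:R / k%:R)%:E.
  elim: m => [|m IH] mk.
    rewrite mul0r (_ : [set w | _] = set0) ?measure0//.
    by apply/seteqP; split => w //= /andP[]; case: (X w).
  rewrite (_ : [set w | _] = [set w | (1 <= X w <= m)%N] `|` [set w | X w = m.+1]).
    rewrite measureU//; last first.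
      by apply/seteqP; split => w //= [/andP[_ h] Xw]; move: h; rewrite Xw ltnn.
    rewrite [X in X + _](IH (ltnW mk)) [X in _ + X](unif m.+1)//.
    by rewrite -EFinD -natr1 mulrDl mul1r.
  apply/seteqP; split => w /=.
    move=> /andP[X1]; rewrite leq_eqVlt ltnS => /orP[/eqP|Xm]; [by right|left].
    by rewrite X1.
  by move=> [/andP[X1 Xm]|->]; rewrite ?leqnn// X1 leqW.
apply/eqP; rewrite eq_le measure_ge0 andbT.
have : P ([set w | (1 <= X w <= k)%N] `|` [set w | X w = j]) <= 1.
  by apply: probability_le1; exact: measurableU.
rewrite measureU//; last first.
  by apply/seteqP; split => w //= [h Xw]; move: jk; rewrite -Xw h.
rewrite [X in X + _]PB// divff ?pnatr_eq0 -?lt0n//.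
by rewrite -[leRHS]adde0 leeD2lE.
Qed.

(** By induction on [n], for the integral over an arbitrary finite intersection
    of events in the variables of index at least [n]: splitting along the value of
    the last summand produces such an intersection for the shorter sum. *)
Lemma integral_expr_partial_sum k (X : nat -> T -> nat) (z : R) n :
  (1 <= k)%N -> (0 <= z)%R -> iid_uniform P k X ->
  \int[P]_w (z ^+ partial_sum X n w)%:E =
  (((\sum_(1 <= j < k.+1) z ^+ j) / k%:R) ^+ n)%:E.
Proof.
move=> k1 z0 [mX indep unif]; set c := ((\sum_(1 <= j < k.+1) z ^+ j) / k%:R)%R.
have c0 : (0 <= c)%R by rewrite divr_ge0// sumr_ge0// => j _; rewrite exprn_ge0.
suff gen (J : {fset nat}) (A : nat -> set T) :
    (forall i, i \in J -> (n <= i)%N) ->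
    (forall i, preimage_set_system setT (X i) measurable (A i)) ->
    \int[P]_(w in \bigcap_(i in [set` J]) A i) (z ^+ partial_sum X n w)%:E =
    (c ^+ n)%:E * P (\bigcap_(i in [set` J]) A i).
  have := gen fset0 (fun=> setT).
  rewrite set_fset0 bigcap_set0 probability_setT mule1; apply; first by move=> i; rewrite inE.
  by move=> i; exists setT; rewrite ?setTI.
elim: n J A => [|n IH] J A Jn XA.
  under eq_integral do rewrite /partial_sum big_ord0 expr0.
  rewrite integral_cst ?expr0//.
  apply: fin_bigcap_measurable => // i _; have [B mB <-] := XA i.
  by rewrite setTI; exact: measurable_preimage.
have mS m : measurable_fun setT (partial_sum X m) by exact: measurable_partial_sum.
have mzS m : measurable_fun setT (fun w => (z ^+ partial_sum X m w)%:E).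
  exact: (measurableT_comp (f := fun i => (z ^+ i)%:E) _ (mS m)).
have zS0 m w : 0 <= (z ^+ partial_sum X m w)%:E by rewrite lee_fin exprn_ge0.
have indepE (J' : {fset nat}) (A' : nat -> set T) :
    (forall i, preimage_set_system setT (X i) measurable (A' i)) ->
    P (\bigcap_(i in [set` J']) A' i) = \prod_(i <- J') P (A' i).
  by move=> XA'; apply: indep.
set B := \bigcap_(i in [set` J]) A i.
have mB : measurable B.
  apply: fin_bigcap_measurable => // i _; have [C mC <-] := XA i.
  by rewrite setTI; exact: measurable_preimage.
have Pfin : P B \is a fin_num by exact: fin_num_measure.
have term j : \int[P]_(w in B `&` X n @^-1` [set j]) (z ^+ partial_sum X n.+1 w)%:E =
    (c ^+ n * fine (P B))%:E * ((z ^+ j)%:E * P [set w | X n w = j]).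
  have mBj : measurable (B `&` X n @^-1` [set j]).
    by apply: measurableI => //; exact: measurable_preimage.
  transitivity (\int[P]_(w in B `&` X n @^-1` [set j])
      ((z ^+ j)%:E * (z ^+ partial_sum X n w)%:E)).
    by apply: eq_integral => w /set_mem[_ /= <-]; rewrite partial_sumS addnC exprD EFinM.
  rewrite ge0_integralZl//; last 2 first.
  - exact: measurable_funTS.
  - by rewrite lee_fin exprn_ge0.
  pose A' i := if i == n then X n @^-1` [set j] else A i.
  have nJ : n \notin J by apply/negP => /Jn; rewrite ltnn.
  have XA' i : preimage_set_system setT (X i) measurable (A' i).
    rewrite /A'; case: eqP => [->|_]; last exact: XA.
    by exists [set j] => //; rewrite setTI.
  have A'J i : i \in J -> A' i = A i.
    by move=> /Jn; rewrite /A'; case: eqP => // ->; rewrite ltnn.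
  have BE : B `&` X n @^-1` [set j] = \bigcap_(i in [set` (n |` J)%fset]) A' i.
    apply/seteqP; split => w.
    - move=> [Bw Xw] i; rewrite /= !inE => /orP[/eqP ->|iJ].
        by rewrite /A' eqxx.
      by rewrite A'J//; exact: Bw.
    - move=> h; split.
        by move=> i iJ; have := h i; rewrite /= A'J//; apply; rewrite !inE iJ orbT.
      by have := h n; rewrite /A' eqxx; apply; rewrite /= !inE eqxx.
  rewrite {1}BE IH//; last first.
    by move=> i; rewrite !inE => /orP[/eqP ->//|/Jn /ltnW].
  rewrite indepE// big_fsetU1//= {1}/A' eqxx.
  rewrite (_ : \prod_(i <- J) P (A' i) = P B); last first.
    by rewrite /B indepE//; apply: eq_big_seq => i iJ; rewrite A'J.
  rewrite -[in LHS](fineK Pfin) EFinM [P (X n @^-1` _) * _]muleC !muleA.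
  by rewrite [(z ^+ j)%:E * _]muleC -!muleA [(z ^+ j)%:E * _]muleCA.
rewrite (integral_partition P (mX n) mB (mzS n.+1))//.
under eq_eseriesr do rewrite term.
have zP0 j : 0 <= (z ^+ j)%:E * P [set w | X n w = j] by rewrite mule_ge0// lee_fin exprn_ge0.
rewrite nneseriesZl//.
have -> : \sum_(j <oo) (z ^+ j)%:E * P [set w | X n w = j] = c%:E.
  rewrite (@nneseries_split _ _ 0 k.+1)// add0n eseries0 ?adde0; last first.
    by move=> j kj _; rewrite (uniform_null k1 (mX n) (unif n)) ?mule0// negb_and -!ltnNge kj orbT.
  rewrite big_ltn// (uniform_null k1 (mX n) (unif n)) ?mule0// add0e.
  rewrite /c mulr_suml -sumEFin; apply: eq_big_nat => j /andP[j1 jk].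
  by rewrite unif ?j1// EFinM.
by rewrite -[in RHS](fineK Pfin) -!EFinM exprSr mulrAC.
Qed.

End CompoundSums.

Section OrderK.
Context d (T : measurableType d) (R : realType) (P : probability T R).
Implicit Types (lambda z t : R) (k : nat).
Local Open Scope ereal_scope.

Lemma poisson_pgf (rate c : R) : (0 < rate)%R -> (0 <= c)%R ->
  \sum_(n <oo) (poisson_pmf rate n)%:E * (c ^+ n)%:E = (expR (rate * (c - 1)))%:E.
Proof.
move=> rate0 c0.
have cexp := @is_cvg_series_exp_coeff R (rate * c)%R.
transitivity (\sum_(n <oo) (expR (- rate))%:E * (exp_coeff (rate * c) n)%:E).
  apply: eq_eseriesr => n _; rewrite /poisson_pmf rate0 /exp_coeff/= -!EFinM exprMn.
  by congr EFin; ring.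
rewrite nneseriesZl; last first.
  by move=> n _; rewrite lee_fin /exp_coeff/= divr_ge0// exprn_ge0// mulr_ge0// ltW.
rewrite mulrBr mulr1 addrC expRD EFinM; congr (_ * _).
apply/cvg_lim => //; under eq_fun do rewrite sumEFin.
by apply/fine_cvgP; split; [exact: nearW|exact: cexp].
Qed.

Lemma PPoK_measurable k lambda (M : R -> T -> nat) t : PPoK P k lambda M ->
  (0 <= t)%R -> measurable_fun setT (M t).
Proof.
move=> [N [X [[mN _ _] [mX _ _] _ ME]]] t0.
rewrite (_ : M t = fun w => partial_sum X (N t w) w); last first.
  by apply/funext => w; rewrite ME.
apply: measurable_nat_family => [|n]; [exact: mN|exact: measurable_partial_sum].
Qed.

(** Up to the intensity, the logarithm of the generating function at time 1 of a
    Poisson process of order [k]. *)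
Definition order_exponent k z : R := \sum_(1 <= j < k.+1) z ^+ j - k%:R.

(** Conditioning on the number of jumps gives the generating function of the
    Poisson law at that of the uniform law. *)
Lemma PPoK_pgf k lambda (M : R -> T -> nat) z t :
  (1 <= k)%N -> (0 < lambda)%R -> (0 <= z)%R -> (0 <= t)%R -> PPoK P k lambda M ->
  \int[P]_w (z ^+ M t w)%:E = (expR (lambda * order_exponent k z * t))%:E.
Proof.
move=> k1 lambda0 z0 t0 PM; have mM := PPoK_measurable PM t0.
have [N [X [[mN [_ N0 _ _ _] PN] iidX indep ME]]] := PM.
have [mX _ _] := iidX.
have mz : measurable_fun setT (fun n => (z ^+ n)%:E) by [].
have kR0 : (0 < k%:R :> R)%R by rewrite ltr0n.
have c0 : (0 <= (\sum_(1 <= j < k.+1) z ^+ j) / k%:R)%R.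
  by rewrite divr_ge0// sumr_ge0// => j _; rewrite exprn_ge0.
have mNt : measurable_fun setT (N t) by exact: mN.
move: t0; rewrite le_eqVlt => /predU1P[t0|t0].
  rewrite -t0 mulr0 expR0.
  rewrite (@ge0_ae_eq_integral _ _ _ P setT _ (cst 1))//.
  - by rewrite integral_cst//= probability_setT mule1.
  - by apply: (measurableT_comp mz); rewrite t0.
  - by move=> w _; rewrite lee_fin exprn_ge0.
  - apply: filterS N0 => w /eqP; rewrite pnatr_eq0 => /eqP N0 _.
    by rewrite ME// N0 big_ord0 expr0.
rewrite (integral_partition P mNt)//; last 2 first.
- exact: (measurableT_comp mz).
- by move=> w; rewrite lee_fin exprn_ge0.
transitivity (\sum_(n <oo) (poisson_pmf (k%:R * lambda * t) n)%:E *
    (((\sum_(1 <= j < k.+1) z ^+ j) / k%:R) ^+ n)%:E); last first.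
  rewrite poisson_pgf ?mulr_gt0//; congr ((expR _)%:E).
  by rewrite /order_exponent; field; rewrite gt_eqF.
apply: eq_eseriesr => n _; rewrite setTI -PN//.
rewrite -(@integral_expr_partial_sum _ _ _ P k X z n)//.
transitivity (\int[P]_(w in N t @^-1` [set n]) (z ^+ partial_sum X n w)%:E).
  by apply: eq_integral => w /set_mem/= <-; rewrite ME// ltW.
apply: (integral_indep (X := partial_sum X n) (g := fun n => (z ^+ n)%:E)) => //.
- exact: measurable_partial_sum.
- exact: measurable_preimage.
- by move=> i; rewrite lee_fin exprn_ge0.
- move=> B mB; apply: indep; last exact: sigma_family_partial_sum.
  by apply: sigma_family_preimage => //; exact: ltW.
Qed.

(** A convergent integer-valued function is eventually constant, so the counting
    process, hence the compound process, is constant on the right of each time. *)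
Lemma PPoK_right_constant k lambda (M : R -> T -> nat) : PPoK P k lambda M ->
  {ae P, forall w, forall t : R, (0 <= t)%R -> \forall x \near t^'+, M x w = M t w}.
Proof.
move=> [N [X [[_ [_ _ _ _ cad] _] _ _ ME]]].
apply: filterS cad => w cad t t0; have [ct _] := cad t t0.
have := ct; move/cvgrPdist_lt => /(_ 1%R ltr01) near1.
near=> x.
have tx : (t < x)%R by near: x; exact: nbhs_right_gt.
have : (`|(N t w)%:R - (N x w)%:R| < 1 :> R)%R by near: x.
rewrite ME ?ME//; last by rewrite (le_trans t0)// ltW.
have -> : ((N t w)%:R - (N x w)%:R : R)%R = ((N t w)%:Z - (N x w)%:Z)%:~R by rewrite intrB.
rewrite -intr_norm -[X in (_ < X)%R]/(1%:~R) ltr_int.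
by rewrite -[X in (_ < X)%R]add0r ltzD1 normr_le0 subr_eq0 eqz_nat => /eqP ->.
Unshelve. all: by end_near.
Qed.

Lemma SPoK_measurable k lambda1 lambda2 (S : R -> T -> R) t :
  SPoK P k lambda1 lambda2 S -> (0 <= t)%R -> measurable_fun setT (S t).
Proof.
move=> [N1 [N2 [P1 P2 _ SE]]] t0.
have mnat : measurable_fun setT (fun n : nat => n%:R : R) by [].
rewrite (_ : S t = (fun w => (N1 t w)%:R) \- (fun w => (N2 t w)%:R))%R; last first.
  by apply/funext => w; rewrite SE.
apply: measurable_funB.
- exact: (measurableT_comp mnat (PPoK_measurable P1 t0)).
- exact: (measurableT_comp mnat (PPoK_measurable P2 t0)).
Qed.

Definition skellam_exponent k lambda1 lambda2 z : R :=
  lambda1 * order_exponent k z + lambda2 * order_exponent k z^-1.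

Lemma SPoK_pgf k lambda1 lambda2 (S : R -> T -> R) z t :
  (1 <= k)%N -> (0 < lambda1)%R -> (0 < lambda2)%R -> (0 < z)%R -> (0 <= t)%R ->
  SPoK P k lambda1 lambda2 S ->
  \int[P]_w (z `^ S t w)%:E = (expR (skellam_exponent k lambda1 lambda2 z * t))%:E.
Proof.
move=> k1 lambda10 lambda20 z0 t0 [N1 [N2 [P1 P2 indep SE]]].
have m1 := PPoK_measurable P1 t0; have m2 := PPoK_measurable P2 t0.
have zV0 : (0 <= z^-1)%R by rewrite invr_ge0 ltW.
transitivity (\int[P]_w ((z ^+ N1 t w)%:E * (z^-1 ^+ N2 t w)%:E)).
  apply: eq_integral => w _; rewrite SE// -EFinM powRD; last by apply/implyP => _; rewrite gt_eqF.
  by rewrite powRN !powR_mulrn ?ltW// exprVn.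
rewrite (@integral_indep_mul _ _ _ P _ _ _ _ (fun n => (z ^+ n)%:E)
  (fun n => (z^-1 ^+ n)%:E) m1 m2)//.
- rewrite (PPoK_pgf k1 lambda10 (ltW z0) t0 P1) (PPoK_pgf k1 lambda20 zV0 t0 P2).
  by rewrite -EFinM -expRD -mulrDl.
- by move=> n; rewrite lee_fin exprn_ge0// ltW.
- by move=> n; rewrite lee_fin exprn_ge0.
- by rewrite (PPoK_pgf k1 lambda20 zV0 t0 P2).
- by move=> n B mB; apply: indep; exact: sigma_family_preimage.
Qed.

Lemma SPoK_right_constant k lambda1 lambda2 (S : R -> T -> R) :
  SPoK P k lambda1 lambda2 S ->
  {ae P, forall w, forall t : R, (0 <= t)%R -> \forall x \near t^'+, S x w = S t w}.
Proof.
move=> [N1 [N2 [P1 P2 _ SE]]].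
have rc1 := PPoK_right_constant P1; have rc2 := PPoK_right_constant P2.
apply: filterS2 rc1 rc2 => w rc1 rc2 t t0.
near=> x.
have tx : (t < x)%R by near: x; exact: nbhs_right_gt.
have x0 : (0 <= x)%R by rewrite (le_trans t0)// ltW.
rewrite !SE//; congr (_%:R - _%:R)%R.
- by near: x; exact: rc1.
- by near: x; exact: rc2.
Unshelve. all: by end_near.
Qed.

End OrderK.

(** * Time change by an independent process *)

Section Subordination.
Context d (T : measurableType d) (R : realType) (P : probability T R).

Lemma measurable_truncn : measurable_fun [set: R] (@Num.truncn R).
Proof.
have m1 n : measurable [set x : R | (Num.truncn x <= n)%N].
  rewrite (_ : [set x | _] = `]-oo, n.+1%:R[%classic)//.
  by apply/seteqP; split => x /=; rewrite in_itv/= truncn_le_nat.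
move=> _ B _; rewrite setTI.
rewrite (_ : _ @^-1` B = \bigcup_(n in B) [set x : R | Num.truncn x = n]); last first.
  by apply/seteqP; split => [x Bx|x [n Bn /= xn]]; [exists (Num.truncn x)|rewrite /= xn].
apply: bigcup_measurable => -[|n] _.
  rewrite (_ : [set x | _] = [set x : R | (Num.truncn x <= 0)%N])//.
  by apply/seteqP; split => x /=; rewrite leqn0 => /eqP.
rewrite (_ : [set x | _] =
    [set x : R | (Num.truncn x <= n.+1)%N] `\` [set x : R | (Num.truncn x <= n)%N]).
  exact: measurableD.
apply/seteqP; split => x /=.
  by move=> ->; rewrite leqnn ltnn.
by move=> [h1 /negP]; rewrite -ltnNge => h2; apply/eqP; rewrite eqn_leq h1.
Qed.

(** Evaluate [S] at [Yn n], the first point of the grid of step [n.+1%:R^-1]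
    strictly to the right of [Y]. For this discrete time independence gives the
    generating function. In the limit the integrands converge because the paths of
    [S] are constant on the right, and the integrals converge because the
    generating function at [z ^+ 2] bounds the second moments. *)
Lemma pgf_subordinated (S : R -> T -> R) (Y : T -> R) (Z : T -> R)
    (z e e2 : R) (L : R -> R) :
  0 < z -> (forall r, 0 <= r -> measurable_fun setT (S r)) ->
  measurable_fun setT Y -> (forall w, 0 <= Y w) -> measurable_fun setT Z ->
  (forall w, Z w = S (Y w) w) ->
  (forall B C r, measurable B -> measurable C -> 0 <= r ->
    P (Y @^-1` B `&` S r @^-1` C) = (P (Y @^-1` B) * P (S r @^-1` C))%E) ->
  {ae P, forall w, forall t : R, 0 <= t -> \forall x \near t^'+, S x w = S t w} ->
  (forall r : R, (0 <= r)%R -> \int[P]_w (z `^ S r w)%:E = (expR (e * r))%:E)%E ->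
  (forall r : R, (0 <= r)%R -> \int[P]_w ((z ^+ 2) `^ S r w)%:E = (expR (e2 * r))%:E)%E ->
  (forall m, \int[P]_w (expR (m * Y w))%:E = (L m)%:E)%E ->
  (\int[P]_w (z `^ Z w)%:E = (L e)%:E)%E.
Proof.
move=> z0 mS mY Y0 mZ ZE indep rc pgf1 pgf2 YL.
pose K n w := (Num.truncn (n.+1%:R * Y w)).+1.
pose q (n : nat) (j : nat) : R := j%:R / n.+1%:R.
have q0 n j : 0 <= q n j by rewrite divr_ge0.
pose Yn n w := q n (K n w).
have mtr n : measurable_fun setT (fun w => Num.truncn (n.+1%:R * Y w)).
  by apply: (measurableT_comp measurable_truncn); exact: measurable_funM.
have mK n : measurable_fun setT (K n).
  by apply: (measurableT_comp (f := succn)) => //; exact: mtr.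
have YYn n w : Y w < Yn n w.
  by rewrite /Yn /q ltr_pdivlMr// mulrC truncnS_gt.
have YnY n w : Yn n w <= Y w + n.+1%:R^-1.
  rewrite /Yn /q ler_pdivrMr// mulrDl mulVf ?pnatr_eq0// /K -natr1 lerD2r mulrC.
  by rewrite truncn_le mulr_ge0.
have Yn0 n w : 0 <= Yn n w by exact: q0.
have mq n : measurable_fun setT (q n : nat -> R) by [].
have mYn n : measurable_fun setT (Yn n) by exact: (measurableT_comp (mq n) (mK n)).
have mSYn n : measurable_fun setT (fun w => S (Yn n w) w).
  by apply: (measurable_nat_family (F := fun j => S (q n j))) => // j; exact: mS.
have mexp m n : measurable_fun setT (fun w => expR (m * Yn n w)) by exact: measurable_expRM.
(* Conditioning on the countably many values of Yn n needs no joint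
   measurability of S in time and outcome. *)
have disc (x m : R) n : 0 < x ->
    (forall r : R, (0 <= r)%R -> \int[P]_w (x `^ S r w)%:E = (expR (m * r))%:E)%E ->
    (\int[P]_w (x `^ S (Yn n w) w)%:E = \int[P]_w (expR (m * Yn n w))%:E)%E.
  move=> x0 pgf.
  have mx : measurable_fun setT (fun y : R => (x `^ y)%:E).
    by apply/measurable_EFinP; exact: measurable_powRr.
  rewrite (integral_partition P (mK n) measurableT)//; last 2 first.
  - exact: (measurableT_comp mx (mSYn n)).
  - by move=> w; rewrite lee_fin powR_ge0.
  rewrite [RHS](integral_partition P (mK n) measurableT)//; last first.
    by apply/measurable_EFinP; exact: mexp.
  apply: eq_eseriesr => j _; rewrite setTI.
  have mKj : measurable (K n @^-1` [set j]) by exact: measurable_preimage.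
  transitivity (\int[P]_(w in K n @^-1` [set j]) (x `^ S (q n j) w)%:E)%E.
    by apply: eq_integral => w /set_mem/= Kj; rewrite /Yn Kj.
  transitivity (\int[P]_(w in K n @^-1` [set j]) (expR (m * q n j))%:E)%E; last first.
    by apply: eq_integral => w /set_mem/= Kj; rewrite /Yn Kj.
  rewrite (integral_indep (P := P) (g := fun y => (x `^ y)%:E) (mS _ (q0 n j)) mKj mx)//.
  - by rewrite pgf// integral_cst// muleC.
  - by move=> y; rewrite lee_fin powR_ge0.
  - move=> C mC.
    have mtrK : measurable ((fun y : R => (Num.truncn (n.+1%:R * y)).+1) @^-1` [set j]).
      apply: measurable_preimage => //.
      have h : measurable_fun setT (fun y : R => Num.truncn (n.+1%:R * y)).
        by apply: (measurableT_comp measurable_truncn); exact: measurable_funM.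
      by apply: (measurableT_comp (f := succn)) => //; exact: h.
    exact: (indep _ _ _ mtrK mC (q0 n j)).
have mexpY m : measurable_fun setT (fun w => (expR (m * Y w))%:E).
  by apply/measurable_EFinP; exact: measurable_expRM.
have dist m n w : `|m * Yn n w - m * Y w| <= `|m| / n.+1%:R.
  rewrite -mulrBr normrM ler_wpM2l// ger0_norm ?subr_ge0 ?(ltW (YYn n w))//.
  by rewrite lerBlDl YnY.
have le_exp m n : (\int[P]_w (expR (m * Yn n w))%:E <= (L m * expR (`|m| / n.+1%:R))%:E)%E.
  rewrite EFinM -YL -ge0_integralZr//.
  apply: ge0_le_integral => //.
  - by apply/measurable_EFinP; exact: mexp.
  - by apply: emeasurable_funM.
  - move=> w _; rewrite -EFinM lee_fin -expRD ler_expR -lerBlDl.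
    exact: le_trans (ler_norm _) (dist m n w).
have ge_exp m n : ((L m * expR (- (`|m| / n.+1%:R)))%:E <= \int[P]_w (expR (m * Yn n w))%:E)%E.
  rewrite EFinM -YL -ge0_integralZr//.
  apply: ge0_le_integral => //.
  - by apply: emeasurable_funM.
  - by apply/measurable_EFinP; exact: mexp.
  - move=> w _; rewrite -EFinM lee_fin -expRD ler_expR lerBlDl -lerBlDr.
    by apply: le_trans (ler_norm _) _; rewrite distrC; exact: dist.
have fin_exp m n : (\int[P]_w (expR (m * Yn n w))%:E)%E \is a fin_num.
  rewrite ge0_fin_numE; first exact: le_lt_trans (le_exp m n) (ltry _).
  by apply: integral_ge0 => w _; rewrite lee_fin expR_ge0.
have L0 m : 0 <= L m.
  by rewrite -lee_fin -YL; apply: integral_ge0 => w _; rewrite lee_fin expR_ge0.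
have cvg_inv (m : R) : m / n.+1%:R @[n --> \oo] --> 0.
  by rewrite -[X in _ --> X](mulr0 m); apply: cvgM; [exact: cvg_cst|exact: cvg_harmonic].
have cvg_Lexp (m : R) : L e * expR (m / n.+1%:R) @[n --> \oo] --> L e.
  have : L e * expR (m / n.+1%:R) @[n --> \oo] --> L e * expR 0.
    apply: cvgM; first exact: cvg_cst.
    by apply: continuous_cvg; [exact: continuous_expR|exact: cvg_inv].
  by rewrite expR0 mulr1.
have cvgYn w : Yn n w @[n --> \oo] --> Y w.
  apply: (@squeeze_cvgr _ _ _ _ (cst (Y w)) (fun n => Y w + 1 / n.+1%:R)).
  - by apply: nearW => n; rewrite (ltW (YYn n w))/= div1r YnY.
  - exact: cvg_cst.
  - by rewrite -[X in _ --> X]addr0; apply: cvgD; [exact: cvg_cst|exact: cvg_inv].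
have mz x (V : T -> R) : measurable_fun setT V -> measurable_fun setT (fun w => x `^ V w).
  exact: (measurableT_comp (measurable_powRr x)).
apply: (@integral_lim_L2_bounded _ _ _ P (fun n w => z `^ S (Yn n w) w) _
  (fun n => fine (\int[P]_w (expR (e * Yn n w))%:E)) _ (L e2 * expR `|e2|)).
- by move=> n; exact: mz.
- exact: mz.
- by move=> n w; exact: powR_ge0.
- by move=> w; exact: powR_ge0.
- apply: filterS rc => w rc; apply: cvg_near_cst.
  have near_S : \forall n \near \oo, Y w < Yn n w -> S (Yn n w) w = S (Y w) w.
    exact: cvgYn (rc _ (Y0 w)).
  by apply: filterS near_S => n SYn; rewrite ZE SYn.
- by move=> n; rewrite (disc _ e)// fineK.
- apply: (@squeeze_cvgr _ _ _ _ (fun n => L e * expR (- (`|e| / n.+1%:R)))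
    (fun n => L e * expR (`|e| / n.+1%:R))).
  + apply: nearW => n; rewrite -!lee_fin fineK//.
    by rewrite le_exp ge_exp.
  + by under eq_fun do rewrite -mulNr; exact: cvg_Lexp.
  + exact: cvg_Lexp.
- move=> n; under eq_integral do rewrite -powR_mulrn ?powR_ge0// powRAC powR_mulrn ?(ltW z0)//.
  rewrite (disc _ e2) ?exprn_gt0//; apply: le_trans (le_exp e2 n) _.
  by rewrite lee_fin ler_wpM2l// ler_expR ler_piMr// invf_le1// ler1n.
Qed.

End Subordination.

Theorem proposition2p2 (d : measure_display) (T : measurableType d)
    (R : realType) (P : probability T R)
    (k : nat) (lambda1 lambda2 alpha : R) (Z : R -> T -> R)
    (hk : (1 <= k)%N) (hlambda1 : 0 < lambda1) (hlambda2 : 0 < lambda2)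
    (halpha : 0 < alpha <= 1)
    (hZ : FSPoK P k lambda1 lambda2 alpha Z)
    (theta t : R) (htheta : 0 < theta < 1) (ht : 0 <= t) :
  'E_P[fun w => (theta `^ Z t w)%R]%E =
   (mittag_leffler alpha
      (- (k%:R * (lambda1 + lambda2)
          - lambda1 * (\sum_(1 <= j < k.+1) theta ^+ j)
          - lambda2 * (\sum_(1 <= j < k.+1) theta ^- j)) * t `^ alpha))%:E.
Proof.
rewrite unlock.
have /andP[theta0 _] := htheta; have /andP[alpha0 _] := halpha.
have -> : - (k%:R * (lambda1 + lambda2)
          - lambda1 * (\sum_(1 <= j < k.+1) theta ^+ j)
          - lambda2 * (\sum_(1 <= j < k.+1) theta ^- j)) =
    skellam_exponent k lambda1 lambda2 theta.
  rewrite /skellam_exponent /order_exponent.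
  have -> : \sum_(1 <= j < k.+1) theta^-1 ^+ j = \sum_(1 <= j < k.+1) theta ^- j.
    by apply: eq_bigr => j _; rewrite exprVn.
  by ring.
case: hZ => [[-> hS]|[_ [S [Y [hS hY indep mZ ZE]]]]].
  by rewrite (SPoK_pgf hk hlambda1 hlambda2 theta0 ht hS) mittag_leffler1 powRr1.
have [_ [_ mY _]] := hY.
apply: (@pgf_subordinated _ _ _ P S (Y t) (Z t) theta
  (skellam_exponent k lambda1 lambda2 theta)
  (skellam_exponent k lambda1 lambda2 (theta ^+ 2))
  (fun m => mittag_leffler alpha (m * t `^ alpha))) => //.
- by move=> r; exact: SPoK_measurable hS.
- exact: mY.
- by move=> w; exact: (inverse_stable_ge0 w ht hY).
- exact: mZ.
- by move=> w; exact: ZE.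
- by move=> B C r mB mC r0; apply: indep; exact: sigma_family_preimage.
- exact: SPoK_right_constant hS.
- by move=> r r0; exact: SPoK_pgf hS.
- by move=> r r0; apply: SPoK_pgf hS => //; exact: exprn_gt0.
- by move=> m; exact: inverse_stable_mgf.
Qed.
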